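(* Let $f:X\to X$ be a map with a single orbit. Then $(X,f)$ is unary FA-presentable if and only if its graph can be obtained in one of the following ways: (1) Start with a finite directed cycle; attach finitely many inward rooted finite trees (at their roots) to the cycle; then to any vertices of the resulting finite graph attach finitely many inwardly oriented periodic paths (at their bases) and finitely many inwardly oriented shallow stars (at their centres). (2) Start with an inward rooted finite tree; to the root attach one outwardly oriented periodic path (at its base); then to any vertices of the resulting graph attach finitely many inwardly oriented periodic paths (at their bases) and finitely many inwardly oriented shallow stars (at their centres).
   Context: The graph of a (partial) map $f:X\to X$ is the directed graph with vertex set $X$ and edges $(x,(x)f)$ for $x$ where $(x)f$ is defined; $x,y$ lie in the same orbit if $(x)f^m=(y)f^n$ for some $m,n\ge0$, i.e. orbits are connected components of the graph. $(X,f)$ is unary FA-presentable if there exist a regular language $L\subseteq a^*$ and a surjection $\phi:L\to X$ such that $\{(u,v)\in L^2:u\phi=v\phi\}$ and $\{(u,v)\in L^2:(u\phi)f=v\phi\}$ are regular relations (words $\mathrm{conv}(u,v)$ over $\{a,\$\}^2$, reading $u,v$ in parallel with the shorter padded by $\$$, form regular languages). Attaching $(T,\eta)$ at $t$ to a vertex $g$ of $(G,\gamma)$: take the disjoint union and identify $g$ with $t$. An inward rooted tree is a directed tree (tree with directed edges) with a distinguished root such that every edge points towards the root (its head lies on the path from its tail to the root). A template is $(T,\eta,t_0,t_1)$, $(T,\eta)$ a finite directed tree, $t_0,t_1\in T$, $t_0$ a leaf; $\mathcal{S}(T,\eta,t_0,t_1)$ is obtained from disjoint copies $(T^{(j)},\eta^{(j)},t^{(j)}_0,t^{(j)}_1)$,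 $j\ge0$, by identifying according to the equivalence relation generated by $\{(t_1^{(j)},t_0^{(j+1)})\}$. If $t_0=t_1$ it is a shallow star with centre the amalgamated vertex; it is inwardly oriented if every edge of the template is oriented towards $t_0$. If $t_0\neq t_1$ it is a periodic path with base $t_0^{(0)}$; it is inwardly oriented if every edge of the template is oriented towards $t_0$, and outwardly oriented if every edge of the template is oriented towards $t_1$. *)

(* Defs.v *)
From mathcomp Require Import all_boot.
Set Implicit Arguments. Unset Strict Implicit. Unset Printing Implicit Defensive.

Record dfa (A : finType) := Dfa {
  dstate : finType; dstart : dstate; dacc : pred dstate;
  dtrans : dstate -> A -> dstate }.

Definition accepts (A : finType) (M : dfa A) (w : seq A) : bool :=
  @dacc A M (foldl (@dtrans A M) (@dstart A M) w).

Definition regular (A : finType) (L : seq A -> Prop) : Prop :=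
  exists M : dfa A, forall w, L w <-> accepts M w.

(* convolution conv(u,v): read in parallel, shorter padded by $ (= None) *)
Definition conv (A : Type) (u v : seq A) : seq (option A * option A) :=
  mkseq (fun i => (onth u i, onth v i)) (maxn (size u) (size v)).

Definition aword (n : nat) : seq unit := nseq n tt.

(* (X,f) unary FA-presentable: L ⊆ a^* (identified with a set of exponents),
   phi : L -> X surjective (phi given as a total function, only its values on
   L matter), and the three languages/relations are regular. *)
Definition unary_FA_presentable (X : Type) (f : X -> X) : Prop :=
  exists (L : nat -> Prop) (phi : nat -> X),
    (forall x, exists n, L n /\ phi n = x) /\
    regular (fun w : seq unit => exists n, L n /\ w = aword n) /\
    regular (fun w : seq (option unit * option unit) =>
      exists m n, [/\ L m, L n, phi m = phi n & w = conv (aword m) (aword n)]) /\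
    regular (fun w : seq (option unit * option unit) =>
      exists m n, [/\ L m, L n, f (phi m) = phi n & w = conv (aword m) (aword n)]).

Definition single_orbit (X : Type) (f : X -> X) : Prop :=
  inhabited X /\ forall x y : X, exists m n, iter m f x = iter n f y.

Unset Implicit Arguments.
Record graph := Graph { vtx : Type; edge : vtx -> vtx -> Prop }.
Arguments edge {g} _ _.
Set Implicit Arguments.

Definition map_graph (X : Type) (f : X -> X) : graph :=
  @Graph X (fun x y => f x = y).

(* G is (up to isomorphism) the graph obtained from B by attaching, for each
   i < k, the graph H i at its vertex h i to the vertex g i of B
   (disjoint union followed by identification of h i with g i). *)
Definition glued (B : graph) (k : nat) (H : 'I_k -> graph)
    (h : forall i, vtx (H i)) (g : 'I_k -> vtx B) (G : graph) : Prop :=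
  exists (iB : vtx B -> vtx G) (iH : forall i, vtx (H i) -> vtx G),
    [/\ injective iB, forall i, injective (iH i),
        forall i, iH i (h i) = iB (g i),
        forall i x y, iH i x = iB y -> x = h i
      & forall i j x y, i <> j -> iH i x = iH j y -> x = h i /\ y = h j] /\
    (forall v, (exists y, v = iB y) \/ (exists i x, v = iH i x)) /\
    (forall u v, edge u v <->
          (exists x y, [/\ edge x y, u = iB x & v = iB y]) \/
          (exists i x y, [/\ edge x y, u = iH i x & v = iH i y])).

Arguments glued : clear implicits.

(* finite directed cycle of length n (n > 0; length 1 is a loop) *)
Definition cycle_graph (n : nat) : graph :=
  @Graph 'I_n (fun i j => val j = (val i).+1 %% n).

Definition adj (T : finType) (e : rel T) : rel T := fun x y => e x y || e y x.

Definition spath (T : finType) (r : rel T) (x : T) (p : seq T) (y : T) : bool :=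
  [&& path r x p, last x p == y & uniq (x :: p)].

Definition dtree (T : finType) (e : rel T) : Prop :=
  [/\ forall x, ~~ e x x,
      forall x y, e x y -> ~~ e y x
    & forall x y, exists! p, spath (adj e) x p y].

Definition oriented_towards (T : finType) (e : rel T) (t : T) : Prop :=
  forall u v, e u v -> forall p, spath (adj e) u p t -> v \in p.

Definition leaf (T : finType) (e : rel T) (t : T) : Prop :=
  #|[pred y | adj e t y]| = 1.

Unset Implicit Arguments.
Record rtree := RTree { rT : finType; re : rel rT; rroot : rT }.
Set Implicit Arguments.

Definition inward_rtree (R : rtree) : Prop :=
  dtree (re R) /\ oriented_towards (re R) (rroot R).

Definition rtree_graph (R : rtree) : graph :=
  @Graph (rT R) (fun x y => re R x y).

Unset Implicit Arguments.
Record template := Template { tT : finType; te : rel tT; t0 : tT; t1 : tT }.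
Set Implicit Arguments.

Definition is_template (P : template) : Prop :=
  dtree (te P) /\ leaf (te P) (t0 P).

(* S(T,eta,t0,t1): vertices are None (the amalgamated t0^(0): centre/base)
   and Some (j,u) for u != t0 (vertex u of copy j); the copy of t0 in copy j
   is None if j = 0 or t0 = t1, and the vertex (j-1, t1) otherwise. *)
Definition Svalid (P : template) (p : option (nat * tT P)) : bool :=
  if p is Some (_, u) then u != t0 P else true.

Definition Svtx (P : template) := {p : option (nat * tT P) | Svalid p}.

Definition Srep (P : template) (j : nat) (u : tT P) : option (nat * tT P) :=
  if u == t0 P then
    (if j is j'.+1 then (if t0 P != t1 P then Some (j', t1 P) else None) else None)
  else Some (j, u).

Definition Sgraph (P : template) : graph :=
  @Graph (Svtx P) (fun a b => exists j u v,
     [/\ te P u v, val a = Srep j u & val b = Srep j v]).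

Definition Sbase (P : template) : vtx (Sgraph P) := exist _ None isT.

(* inwardly oriented shallow star (t0 = t1) or periodic path (t0 <> t1) *)
Definition inward_template (P : template) : Prop :=
  is_template P /\ oriented_towards (te P) (t0 P).

Definition outward_path (P : template) : Prop :=
  [/\ is_template P, t0 P <> t1 P & oriented_towards (te P) (t1 P)].

Definition attach_inward (B G : graph) : Prop :=
  exists (m : nat) (P : 'I_m -> template) (g : 'I_m -> vtx B),
    (forall i, inward_template (P i)) /\
    glued B m (fun i => Sgraph (P i)) (fun i => Sbase (P i)) g G.

Definition obtainable1 (G : graph) : Prop :=
  exists (n : nat) (k : nat) (R : 'I_k -> rtree) (g : 'I_k -> 'I_n) (B1 : graph),
    [/\ 0 < n, forall i, inward_rtree (R i),
        glued (cycle_graph n) k (fun i => rtree_graph (R i))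
              (fun i => rroot (R i)) g B1
      & attach_inward B1 G].

Definition obtainable2 (G : graph) : Prop :=
  exists (R : rtree) (P : template) (B1 : graph),
    [/\ inward_rtree R, outward_path P,
        glued (rtree_graph R) 1 (fun _ => Sgraph P)
              (fun _ => Sbase P) (fun _ => rroot R) B1
      & attach_inward B1 G].

(* Main.v *)
Require Import Defs.
From Stdlib Require Import ClassicalEpsilon.
From mathcomp Require Import all_boot zify.
Set Implicit Arguments. Unset Strict Implicit. Unset Printing Implicit Defensive.

(** A relation on [a^*] is regular exactly when it is eventually periodic both
    along the common length of the two words and along their difference.
    Passing to shortlex-least representatives, a unary FA-presentable map is
    thus, up to finitely many points, given on finitely many copies [I * nat]
    of the naturals by [f (i, j) = x_i] or [f (i, j) = (q i, j + s_i)]; and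
    conversely.  Cutting each cycle of [q] at one point turns [I] into a forest,
    and after realigning the copies [f] preserves the level [j] except at the
    roots.  A root where [f] is constant gives a shallow star, a root where
    [f] descends [d] levels gives [d] inward periodic paths, and, since there
    is a single orbit, at most one root ascends, by exactly one level: it
    gives the outward periodic path.  What lies below a large enough level is
    a finite functional graph, i.e. a cycle with trees, or a finite tree. *)

(** The cycles of [q] are cut because offsets can absorb the shifts [s_i] only along a forest:
    around a cycle the sum of the shifts does not depend on the offsets. Cutting concentrates this
    sum at one root, where its sign tells a descent from an ascent. A descent by [d] levels
    preserves residues modulo [d], hence [d] separate paths. An ascent keeps forward orbits in its
    own tree of copies and in one residue class, so two ascending roots, or an ascent by anything
    but one level, would give more than one orbit.

    Constant shifts come from a single number [D], a factorial, that is threshold and period at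
    once. A long gap between a word and its image lets the longer word grow alone, so the image
    stays fixed; a long common prefix lets both grow together, so the image moves in parallel.

    Both implications pass through [ladders]. A template yields one ladder for each vertex other
    than [t0], so automata never meet the gluing. *)

(** * Classical choice and uniform bounds over finite types *)

Definition cbool (P : Prop) : bool :=
  if excluded_middle_informative P then true else false.

Lemma cboolP (P : Prop) : reflect P (cbool P).
Proof. by rewrite /cbool; case: excluded_middle_informative => h; constructor. Qed.

Lemma fun_choice (A B : Type) (R : A -> B -> Prop) :
  (forall x, exists y, R x y) -> exists g, forall x, R x (g x).
Proof.
move=> H; exists (fun x => proj1_sig (constructive_indefinite_description _ (H x))) => x.
exact: proj2_sig.
Qed.

Lemma fin_bound (T : finType) (g : T -> nat) : exists B, forall t, g t <= B.
Proof. by exists (\max_t g t) => t; apply: leq_bigmax. Qed.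

Lemma fin_bound_ex (T : finType) (P : T -> nat -> Prop) :
  (forall t, exists B, forall n, B <= n -> P t n) ->
  exists B, forall t n, B <= n -> P t n.
Proof.
move=> /fun_choice[g gP]; have [B HB] := fin_bound g.
by exists B => t n Bn; apply: gP; apply: leq_trans (HB t) Bn.
Qed.

(** * Unary automatic relations *)

(** The orbit closes up within [#|S|] steps and the loop length divides the factorial of [n]; as [n]
    is at most its factorial, one number is both threshold and period. *)
Lemma iter_eventually_periodic (S : finType) (g : S -> S) (x : S) (n m : nat) :
  #|S| <= n -> n`! <= m -> iter (m + n`!) g x = iter m g x.
Proof.
move=> Sn nm.
have /loopingP/(_ (order g x)) := looping_order g x.
move=> /trajectP[i ilt Ei].
have olt : order g x <= n by apply: leq_trans (max_card _) Sn.
have nfact : n <= n`! by elim: (n) => // k IH; rewrite factS; have := fact_gt0 k; nia.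
set d := order g x - i.
have step k : i <= k -> iter (k + d) g x = iter k g x.
  move=> ik; have -> : k + d = (k - i) + order g x by rewrite /d; lia.
  by rewrite iterD Ei -iterD subnK.
have dn : d %| n`! by apply: dvdn_fact; rewrite /d; lia.
rewrite -(divnK dn); elim: (_ %/ d) => [|k IH]; first by rewrite addn0.
have -> : m + k.+1 * d = m + k * d + d by lia.
by rewrite step ?IH //; lia.
Qed.

(** [p] is the length of the common prefix, [q] that of the padded tail; this half has the longer
    word on the first track. *)
Definition half_periodic (D : nat) (R : nat -> nat -> Prop) : Prop :=
  forall p q, (D <= p -> (R (p + q) p <-> R (p + D + q) (p + D))) /\
              (D <= q -> (R (p + q) p <-> R (p + q + D) p)).

Definition periodic (D : nat) (R : nat -> nat -> Prop) : Prop :=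
  half_periodic D R /\ half_periodic D (fun m n => R n m).

Local Notation letter := (option unit * option unit)%type.
Definition both : letter := (Some tt, Some tt).
Definition excess (b : bool) : letter := if b then (Some tt, None) else (None, Some tt).

Definition padded (b : bool) (p q : nat) : seq letter :=
  nseq p both ++ nseq q (excess b).

Lemma onth_aword n i : onth (aword n) i = if i < n then Some tt else None.
Proof. by have := onthTE (aword n) i; rewrite size_nseq; case: onth => [[]|] /= <-. Qed.

Lemma convE m n : conv (aword m) (aword n) =
  padded (n <= m) (minn m n) (maxn m n - minn m n).
Proof.
apply: (@eq_from_nth _ both).
  by rewrite /conv size_mkseq size_cat !size_nseq; lia.
move=> i; rewrite size_mkseq !size_nseq => ilt.
rewrite nth_mkseq ?size_nseq // !onth_aword nth_cat !nth_nseq size_nseq.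
case: (leqP n m) => nm.
  have -> : i < m by lia. rewrite /excess /both; case: ltnP => h //.
  by have -> : i - n < m - n by lia.
have -> : i < n by lia. rewrite /excess /both; case: ltnP => h //.
by have -> : i - m < n - m by lia.
Qed.

Lemma conv_padded b p q :
  conv (aword (if b then p + q else p)) (aword (if b then p else p + q)) = padded b p q.
Proof.
rewrite convE; case: b; last case: q => [|q].
- have -> : p <= p + q by lia. congr padded; lia.
- rewrite addn0 leqnn minnn maxnn subnn //.
have -> : (p + q.+1 <= p) = false by lia. congr padded; lia.
Qed.

Lemma conv_inj m n m' n' :
  conv (aword m) (aword n) = conv (aword m') (aword n') -> m = m' /\ n = n'.
Proof.
have c1 k l : count (fun x : letter => x.1 == Some tt) (conv (aword k) (aword l)) = k.
  rewrite convE count_cat !count_nseq /= ; case: leqP => h /=; lia.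
have c2 k l : count (fun x : letter => x.2 == Some tt) (conv (aword k) (aword l)) = l.
  rewrite convE count_cat !count_nseq /= ; case: leqP => h /=; lia.
move=> E; split; first by rewrite -(c1 m n) E c1.
by rewrite -(c2 m n) E c2.
Qed.

Lemma foldl_nseq (S A : Type) (t : S -> A -> S) s a n :
  foldl t s (nseq n a) = iter n (t^~ a) s.
Proof. by elim: n s => // n IH s; rewrite iterSr -IH. Qed.

Definition conv_lang (R : nat -> nat -> Prop) (w : seq letter) : Prop :=
  exists m n, R m n /\ w = conv (aword m) (aword n).

Lemma conv_lang_conv R m n : conv_lang R (conv (aword m) (aword n)) <-> R m n.
Proof.
split; last by exists m, n.
by move=> [m' [n' [h /conv_inj[-> ->]]]].
Qed.

(** A convolution is a block of one letter followed by a block of another, so a run iterates two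
    fixed maps. Any bound [N] on the number of states will do, which lets several automata share a
    period. *)
Lemma dfa_periodic (M : dfa letter) R N :
  #|dstate M| <= N -> (forall w, conv_lang R w <-> accepts M w) -> periodic (N`!) R.
Proof.
move=> SN HM; set D := N`!.
have key b p q : R (if b then p + q else p) (if b then p else p + q) <->
    accepts M (padded b p q).
  by rewrite -conv_padded -HM conv_lang_conv.
have shift b p q :
   (D <= p -> accepts M (padded b p q) = accepts M (padded b (p + D) q)) /\
   (D <= q -> accepts M (padded b p q) = accepts M (padded b p (q + D))).
  rewrite /accepts /padded !foldl_cat !foldl_nseq.
  by split=> h; rewrite iter_eventually_periodic.
split=> p q; split=> h.
- have [/(_ h) E _] := shift true p q.
  by rewrite (key true p q) (key true (p + D) q) E.
- have [_ /(_ h) E] := shift true p q.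
  by rewrite -addnA (key true p q) (key true p (q + D)) E.
- have [/(_ h) E _] := shift false p q.
  by rewrite (key false p q) (key false (p + D) q) E.
have [_ /(_ h) E] := shift false p q.
by rewrite -addnA (key false p q) (key false p (q + D)) E.
Qed.

(** * Counter automata for periodic relations *)

(** The representative below [D + D] of a length, when lengths of at least [D] are identified modulo
    [D]. *)
Definition cap (D x : nat) : nat := if x < D then x else D + (x - D) %% D.

Lemma cap_lt D x : 0 < D -> cap D x < D + D.
Proof. by move=> h; rewrite /cap; case: (ltnP x D) => k; [lia|rewrite ltn_add2l ltn_mod]. Qed.

Lemma cap_addn D x : exists k, x = cap D x + k * D /\ (0 < k -> D <= cap D x).
Proof.
rewrite /cap; case: ltnP => h; first by exists 0; split; lia.
by exists ((x - D) %/ D); split; [have := divn_eq (x - D) D; lia|lia].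
Qed.

Lemma cap_shift D x y k : y = x + k * D -> (0 < k -> D <= x) -> cap D y = cap D x.
Proof.
move=> -> h; rewrite /cap; case: k h => [|k] h; first by rewrite addn0.
have {}h := h isT; rewrite !ltnNge h (leq_trans h (leq_addr _ _)) /=.
by congr (D + _); rewrite -addnBAC // addnC modnMDl.
Qed.

Lemma capS D x : cap D (cap D x).+1 = cap D x.+1.
Proof.
have [k [E h]] := cap_addn D x; symmetry; apply: (@cap_shift _ _ _ k); first lia.
by move=> /h; lia.
Qed.

Lemma half_periodic_cap D R p q :
  half_periodic D R -> R (p + q) p <-> R (cap D p + cap D q) (cap D p).
Proof.
move=> HR; have [k [Ep hk]] := cap_addn D p; have [l [Eq hl]] := cap_addn D q.
set p' := cap D p in Ep hk *; set q' := cap D q in Eq hl *.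
have A : R (p + q) p <-> R (p' + q) p'.
  rewrite Ep; elim: k hk {Ep} => [|k IH] hk; first by rewrite addn0.
  have hp := hk isT.
  have [/(_ _) H _] := HR (p' + k * D) q.
  have -> : p' + k.+1 * D = p' + k * D + D by lia.
  by rewrite -H ?IH //; lia.
rewrite A Eq; elim: l hl {Eq} => [|l IH] hl; first by rewrite addn0.
have hq := hl isT.
have [_ H] := HR p' (q' + l * D).
have -> : p' + (q' + l.+1 * D) = p' + (q' + l * D) + D by lia.
by rewrite -H ?IH //; lia.
Qed.

Section CounterAutomaton.
Variables (D : nat) (R : nat -> nat -> Prop).
Hypothesis D_gt0 : 0 < D.

Definition counter (x : nat) : 'I_(D + D) := Ordinal (cap_lt x D_gt0).

(* A state records which track is still running ([None]: both so far) and the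
   two capped block lengths; the outer [None] is the sink. *)
Definition cstate : finType := option (option bool * 'I_(D + D) * 'I_(D + D)).

Definition cstep (s : cstate) (a : letter) : cstate :=
  match s with
  | None => None
  | Some (ph, c, d) =>
      match a with
      | (Some _, Some _) => if ph is None then Some (None, counter c.+1, d) else None
      | (None, None) => None
      | (Some _, None) =>
          if ph == Some false then None else Some (Some true, c, counter d.+1)
      | (None, Some _) =>
          if ph == Some true then None else Some (Some false, c, counter d.+1)
      end
  end.

Definition cacc (s : cstate) : bool :=
  match s with
  | None => false
  | Some (ph, c, d) =>
      if ph == Some false then cbool (R c (c + d)) else cbool (R (c + d) c)
  end.

Definition counter_dfa : dfa letter := Dfa (Some (None, counter 0, counter 0)) cacc cstep.

Lemma counterS x : counter (counter x).+1 = counter x.+1.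
Proof. by apply: val_inj; rewrite /= capS. Qed.

Lemma run_padded b p q : foldl cstep (dstart counter_dfa) (padded b p q) =
  Some (if q is 0 then None else Some b, counter p, counter q).
Proof.
rewrite /padded foldl_cat !foldl_nseq.
have -> : iter p (cstep^~ both) (dstart counter_dfa) = Some (None, counter p, counter 0).
  by elim: p => // p IH; rewrite iterS IH /= counterS.
by elim: q => // q IH; rewrite iterS IH; case: b {IH}; case: q => [|q] /=; rewrite counterS.
Qed.

(** Words that are not convolutions end in the sink, so acceptance can rely on the track and the two
    counters alone. *)
Lemma run_inv w s : foldl cstep (dstart counter_dfa) w = Some s ->
  exists b p q, w = padded b p q.
Proof.
elim/last_ind: w s => [|w a IH] s; first by exists true, 0, 0.
rewrite foldl_rcons; case E: foldl => [s'|] // Es.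
have [b [p [q Ew]]] := IH _ E.
move: E; rewrite Ew run_padded => -[E]; move: Es; rewrite -E {E IH w Ew}.
have rnseq (c : letter) n : rcons (nseq n c) c = nseq n.+1 c by elim: n => // n /= ->.
case: q => [|q]; case: a => [[[]|] [[]|]] //=.
- by exists true, p.+1, 0; rewrite /padded /= !cats0 rnseq.
- by exists true, p, 1; rewrite /padded rcons_cat.
- by exists false, p, 1; rewrite /padded rcons_cat.
- by case: b => // _; exists true, p, q.+2; rewrite /padded rcons_cat rnseq.
by case: b => // _; exists false, p, q.+2; rewrite /padded rcons_cat rnseq.
Qed.
End CounterAutomaton.

(** Acceptance is a finite table of truth values of [R] at capped lengths, filled in classically by
    [cbool]. *)
Lemma periodic_regular D R : 0 < D -> periodic D R -> regular (conv_lang R).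
Proof.
move=> D_gt0 [H1 H2]; exists (counter_dfa R D_gt0) => w; rewrite /accepts /=.
have key b p q :
    R (if b then p + q else p) (if b then p else p + q) <->
    cacc R (foldl (cstep D_gt0) (dstart (counter_dfa R D_gt0)) (padded b p q)).
  rewrite run_padded /=; case: b.
    have -> : ((if q is 0 then None else Some true) == Some false) = false by case: q.
    by rewrite (half_periodic_cap p q H1); split=> /cboolP.
  (* With an empty tail no track has been recorded, and both readings of the table agree. *)
  case: q => [|q] /=.
    by have := half_periodic_cap p 0 H1; rewrite addn0 => ->; split=> /cboolP.
  rewrite (half_periodic_cap p q.+1 H2) /=; by split=> /cboolP.
split=> [[m [n [h ->]]]|].
  move: h; case: (leqP n m) => nm.
    by have := key true n (m - n); rewrite subnKC // => -> ; rewrite -conv_padded subnKC.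
  by have := key false m (n - m); rewrite subnKC ?(ltnW nm) // => ->; rewrite -conv_padded subnKC // ltnW.
case E: (foldl _ _ w) => [s|] //.
have [b [p [q Ew]]] := run_inv (R := R) E.
rewrite -E Ew => h; exists (if b then p + q else p), (if b then p else p + q).
by split; [apply/key|rewrite conv_padded].
Qed.

Lemma regular_eq (A : finType) (L1 L2 : seq A -> Prop) :
  (forall w, L1 w <-> L2 w) -> regular L1 -> regular L2.
Proof. by move=> E [M HM]; exists M => w; rewrite -E HM. Qed.

Lemma regular_diagonal (L : nat -> Prop) :
  regular (conv_lang (fun m n => L m /\ m = n)) ->
  regular (fun w : seq unit => exists n, L n /\ w = aword n).
Proof.
move=> [M HM].
exists (Dfa (dstart M) (@dacc _ M) (fun s _ => dtrans s both)) => w.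
have -> : w = aword (size w) by elim: w => //= [[] w] {1}->.
have -> : accepts (Dfa (dstart M) (@dacc _ M) (fun s _ => dtrans s both)) (aword (size w))
   = accepts M (conv (aword (size w)) (aword (size w))).
  have := conv_padded true (size w) 0; rewrite addn0 => ->.
  by rewrite /accepts /padded cats0 !foldl_nseq.
rewrite -HM conv_lang_conv; split=> [[n [Ln E]]|[Ln _]]; last by exists (size w).
by have := congr1 size E; rewrite !size_nseq => ->.
Qed.

(** * Ladder decompositions *)

(* Up to finitely many points (which may also lie on a ladder), the vertices
   split into finitely many sequences [rung i 0, rung i 1, ...], and the edges
   leaving a sequence eventually end at a fixed vertex or run in parallel to
   another sequence. *)
Record ladders (G : graph) := Ladders {
  lfin : finType;
  lidx : finType;
  lpt : lfin -> vtx G;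
  rung : lidx -> nat -> vtx G;
  rung_inj : forall i j i' j', rung i j = rung i' j' -> i = i' /\ j = j';
  ladders_cover : forall x, (exists y, x = lpt y) \/ (exists i j, x = rung i j);
  rung_edge : forall i,
    (exists x a, forall j, edge (rung i (j + a)) x) \/
    (exists i' a b, forall j, edge (rung i (j + a)) (rung i' (j + b))) }.
Arguments rung {G} _ _ _.
Arguments ladders_cover {G} _ _.
Arguments rung_edge {G} _ _.

(** Each vertex keeps only its least word. Beyond a few multiples of [D] these words form a union of
    residue classes modulo [D], and each class is a ladder. *)
Lemma presentable_ladders (X : Type) (f : X -> X) :
  unary_FA_presentable f -> inhabited (ladders (map_graph f)).
Proof.
move=> [L [phi [surj [[M1 H1] [[M2 H2] [M3 H3]]]]]].
pose N := #|dstate M1| + #|dstate M2| + #|dstate M3|.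
pose D := N`!; have D_gt0 : 0 < D := fact_gt0 N.
pose E m n := [/\ L m, L n & phi m = phi n].
pose R m n := [/\ L m, L n & f (phi m) = phi n].
have perE : periodic D E.
  apply: (@dfa_periodic M2); first by rewrite /N addnAC leq_addl.
  move=> w; rewrite -H2; split=> [[m [n [[h1 h2 h3] h4]]]|[m [n [h1 h2 h3 h4]]]];
  by exists m, n; split.
have perR : periodic D R.
  apply: (@dfa_periodic M3); first by rewrite /N leq_addl.
  move=> w; rewrite -H3; split=> [[m [n [[h1 h2 h3] h4]]]|[m [n [h1 h2 h3 h4]]]];
  by exists m, n; split.
have perL m : D <= m -> L m <-> L (m + D).
  have LE k : L k <-> E k k by split=> [h|[]].
  move=> h; have [/(_ h) A _] := perE.1 m 0.
  by rewrite !LE; move: A; rewrite !addn0.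
have [g gP] : exists g : X -> nat, forall x,
    [/\ L (g x), phi (g x) = x & forall n, L n -> phi n = x -> g x <= n].
  have H x : exists n, [/\ L n, phi n = x & forall k, L k -> phi k = x -> n <= k].
    have ex : exists n, cbool (L n /\ phi n = x).
      by have [n h] := surj x; exists n; apply/cboolP.
    case: (ex_minnP ex) => n /cboolP[Ln pn] mn; exists n; split=> // k Lk pk.
    by apply: mn; apply/cboolP.
  by have [choice_f ?] := fun_choice H; exists choice_f.
have g_inj x y : g x = g y -> x = y.
  by move=> h; have [_ <- _] := gP x; have [_ <- _] := gP y; rewrite h.
pose C m := L m /\ g (phi m) = m.
have Cg x : C (g x) by have [h1 h2 _] := gP x; split; rewrite ?h2.
have nC m : L m -> ~ C m -> exists2 n, n < m & E m n.
  move=> Lm h; have [h1 h2 h3] := gP (phi m); exists (g (phi m)); last by split.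
  have := h3 _ Lm erefl; rewrite leq_eqVlt => /orP[/eqP e|//].
  by case: h; split.
have Cn m n : n < m -> E m n -> ~ C m.
  move=> nm [Lm Ln e] [_ h]; have [_ _ h3] := gP (phi m).
  by have := h3 n Ln (esym e); rewrite h; lia.
(* A shorter equivalent word either is long enough for both words to shift by [D], or leaves a gap
   that lets the longer word shift alone; [3 * D] ensures that one of the two applies. *)
have perC m : 3 * D <= m -> C m <-> C (m + D).
  move=> hm; split=> h; apply: NNPP => h'.
    have Lm' : L (m + D) := (perL m ltac:(lia)).1 h.1.
    have [n nm e] := nC _ Lm' h'.
    case: (leqP (2 * D) n) => hn.
      apply: (@Cn m (n - D)) h; first lia.
      have [A _] := perE.1 (n - D) (m + D - n).
      have {A} := A ltac:(lia); rewrite subnK; last lia.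
      have -> : n - D + (m + D - n) = m by lia.
      have -> : n + (m + D - n) = m + D by lia. by move=> ->.
    apply: (@Cn m n) h; first lia.
    have [_ A] := perE.1 n (m - n).
    have {A} := A ltac:(lia); have -> : n + (m - n) = m by lia.
    by move=> ->.
  have Lm : L m := (perL m ltac:(lia)).2 h.1.
  have [n nm e] := nC _ Lm h'.
  case: (leqP D n) => hn.
    apply: (@Cn (m + D) (n + D)) h; first lia.
    have [A _] := perE.1 n (m - n).
    have {A} := A hn; have -> : n + (m - n) = m by lia.
    have -> : n + D + (m - n) = m + D by lia. by move=> <-.
  apply: (@Cn (m + D) n) h; first lia.
  have [_ A] := perE.1 n (m - n).
  have {A} := A ltac:(lia); have -> : n + (m - n) = m by lia.
  by move=> <-.
have CR m : C m -> R m (g (f (phi m))).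
  by move=> [Lm _]; have [h1 h2 _] := gP (f (phi m)); split.
have RC m n : R m n -> C n -> g (f (phi m)) = n.
  by move=> [_ _ ->] [].
have C_inj m n : C m -> C n -> phi m = phi n -> m = n.
  by move=> [_ h1] [_ h2] h; rewrite -h1 -h2 h.
have perCk m k : 3 * D <= m -> C m <-> C (m + k * D).
  move=> hm; elim: k => [|k IH]; first by rewrite addn0.
  have -> : m + k.+1 * D = m + k * D + D by lia. rewrite -perC ?IH //; lia.
(* An image below [3 * D] leaves a gap of at least [D] and stays fixed when [m] grows by [D]; a
   higher image grows along. *)
have stepR m : C m -> 4 * D <= m -> let n := g (f (phi m)) in
    if n < 3 * D then g (f (phi (m + D))) = n
    else m < n + D /\ g (f (phi (m + D))) = n + D.
  move=> Cm hm n; have Rmn : R m n := CR _ Cm; have Cnn : C n := Cg _.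
  case: ltnP => hn.
    apply: RC => //; have [_ A] := perR.1 n (m - n).
    have {A} := A ltac:(lia); have -> : n + (m - n) = m by lia.
    by move=> <-.
  have CnD : C (n + D) := (perC n hn).1 Cnn.
  have RD : R (m + D) (n + D).
    case: (leqP n m) => nm.
      have [A _] := perR.1 n (m - n).
      have {A} := A ltac:(lia); have -> : n + (m - n) = m by lia.
      have -> : n + D + (m - n) = m + D by lia. by move=> <-.
    have [A _] := perR.2 m (n - m).
    have {A} := A ltac:(lia); have -> : m + (n - m) = n by lia.
    have -> : m + D + (n - m) = n + D by lia. by move=> <-.
  split; last exact: RC.
  (* After a drop of [D] or more, the gap would let [m] grow alone, and [m + D] would be sent to [n]
     as well as to [n + D]. *)
  rewrite ltnNge; apply/negP => nm.
  have [_ A] := perR.1 n (m - n).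
  have {A} := A ltac:(lia); have -> : n + (m - n) = m by lia.
  move=> [/(_ Rmn)[_ _ e1] _]; have [_ _ e2] := RD.
  by have := C_inj _ _ Cnn CnD (etrans (esym e1) e2); lia.
pose I := {i : 'I_D | cbool (C (4 * D + i))}.
pose e (i : I) j := phi (4 * D + val (val i) + j * D).
have Ce (i : I) j : C (4 * D + val (val i) + j * D).
  by apply: (perCk _ j _).1; [lia|apply/cboolP; apply: (valP i)].
have e_of m : C m -> 4 * D <= m -> exists i : I, forall j,
    phi (m + j * D) = e i (j + (m - 4 * D) %/ D).
  move=> Cm hm; have := divn_eq (m - 4 * D) D.
  set q := _ %/ D; set r := _ %% D => Em.
  have rD : r < D by rewrite ltn_mod.
  have Cr : cbool (C (4 * D + Ordinal rD)).
    apply/cboolP; apply: (perCk _ q _).2; first lia.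
    by rewrite /=; have -> : 4 * D + r + q * D = m by lia.
  by exists (exist _ (Ordinal rD) Cr) => j; rewrite /e /=; congr phi; lia.
split; apply: (@Ladders (map_graph f) 'I_(4 * D) I (fun i => phi i) e).
- move=> i j i' j' /(C_inj _ _ (Ce _ _) (Ce _ _)) h.
  have h3 : val (val i) + j * D = val (val i') + j' * D.
    by apply: (@addnI (4 * D)); rewrite !addnA.
  have h1 : val (val i) < D := ltn_ord _; have h2 : val (val i') < D := ltn_ord _.
  have Ej : j = j'.
    have := congr1 (divn^~ D) h3; rewrite /= ![_ + _ * D]addnC !divnMDl //.
    by rewrite !divn_small // !addn0.
  by split=> //; do 2!apply: val_inj; move: h3; rewrite Ej => /addIn.
- move=> x; have [Lx px _] := gP x; case: (ltnP (g x) (4 * D)) => h.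
    by left; exists (Ordinal h); rewrite /= px.
  right; have [i Hi] := e_of _ (Cg x) h.
  by exists i, (0 + (g x - 4 * D) %/ D); rewrite -Hi addn0 px.
(* Starting at level 1 gives [m] at least [5 * D]; the drop is less than [D], so a moving image is
   at least [4 * D] and lies on a ladder. *)
move=> i; set m := 4 * D + val (val i) + 1 * D.
have Cm : C m := Ce i 1.
have := stepR _ Cm ltac:(lia); rewrite /=; set n := g (f (phi m)).
have em j : e i (j + 1) = phi (m + j * D) by rewrite /e mulnDl [j * D + _]addnC addnA.
case: (ltnP n (3 * D)) => hn Hn /=.
  left; exists (phi n), 1 => j; rewrite em.
  suff <- : g (f (phi (m + j * D))) = n by have [] := gP (f (phi (m + j * D))).
  elim: j => [|j IH]; first by rewrite addn0.
  have := stepR _ ((perCk m j ltac:(lia)).1 Cm); rewrite /= IH hn.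
  have -> : m + j.+1 * D = m + j * D + D by lia.
  by apply; lia.
right; have hn' : 4 * D <= n by rewrite /m in Hn; lia.
have [i' Hi'] := e_of n (Cg _) hn'.
exists i', 1, ((n - 4 * D) %/ D) => j; rewrite em -Hi'.
suff <- : g (f (phi (m + j * D))) = n + j * D by have [] := gP (f (phi (m + j * D))).
elim: j => [|j IH]; first by rewrite !addn0.
have := stepR _ ((perCk m j ltac:(lia)).1 Cm); rewrite /= IH ltnNge (leq_trans hn (leq_addr _ _)) /=.
have -> : m + j.+1 * D = m + j * D + D by lia.
by move=> /(_ ltac:(lia))[_ ->]; lia.
Qed.

(** * From ladders back to a unary presentation *)

(** Equality on [X] is only classical, so repetitions are removed by keeping the index of least rank
    in each fibre of [g]. *)
Lemma finite_range_enum (X : Type) (F : finType) (g : F -> X) (P : X -> Prop) :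
  exists (Y : finType) (h : Y -> X), injective h /\
    forall x, (exists y, x = h y) <-> (exists z, x = g z) /\ P x.
Proof.
pose first y := P (g y) /\ forall z, g z = g y -> enum_rank y <= enum_rank z.
exists {y : F | cbool (first y)}, (fun y => g (val y)); split.
  move=> y z E; apply: val_inj; apply: enum_rank_inj; apply: val_inj => /=.
  have /cboolP[_ hy] := valP y; have /cboolP[_ hz] := valP z.
  by apply/eqP; rewrite eqn_leq hy ?hz.
move=> x; split=> [[y ->]|[[z ->] Pz]].
  by have /cboolP[h _] := valP y; split=> //; exists (val y).
have cz : cbool (g z = g z) by apply/cboolP.
case: (@arg_minnP _ z (fun y => cbool (g y = g z)) (fun y => enum_rank y) cz).
move=> y /cboolP Ey miny.
have fy : cbool (first y).
  apply/cboolP; split; first by rewrite Ey.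
  by move=> w Ew; apply: miny; apply/cboolP; rewrite Ew.
by exists (exist _ y fy).
Qed.

(** Each vertex has the single word of length [c x], so equality is the diagonal. Raising the code
    of [x] by [D] either leaves the image in place below [D], where only the gap can be long, or
    raises it by [D], where only the common prefix can be. *)
Lemma code_presentable (X : Type) (f : X -> X) (c : X -> nat) (D : nat) :
  inhabited X -> 0 < D -> injective c ->
  (forall x, c (f x) < c x + D) ->
  (forall x, D <= c x -> exists x', c x' = c x + D /\
     ((f x' = f x /\ c (f x) < D) \/
      (c (f x') = c (f x) + D /\ c x < c (f x) + D))) ->
  (forall x', D + D <= c x' -> exists x, c x' = c x + D) ->
  unary_FA_presentable f.
Proof.
move=> [x0] D_gt0 c_inj T1 T2 T3.
have [phi phiP] : exists phi : nat -> X, forall x, phi (c x) = x.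
  have H n : exists x, forall y, c y = n -> x = y.
    case: (classic (exists y, c y = n)) => [[y <-]|h].
      by exists y => z /c_inj.
    by exists x0 => y Ey; case: h; exists y.
  exists (fun n => proj1_sig (constructive_indefinite_description _ (H n))) => x.
  by case: constructive_indefinite_description => y /= /(_ x erefl).
pose L n := exists x, c x = n.
pose Q m n := L m /\ m = n.
pose R m n := exists x, c x = m /\ c (f x) = n.
have perL m : D <= m -> L m <-> L (m + D).
  move=> h; split=> [[x Ex]|[x' Ex']].
    by have [|x' [Ex' _]] := T2 x; [rewrite Ex|exists x'; rewrite Ex' Ex].
  by have [|x Ex] := T3 x'; [lia|exists x; lia].
have perQ : periodic D Q.
  split=> p q; split=> h; rewrite /Q.
  - have := perL _ h; case: q => [|q]; first by rewrite !addn0; tauto.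
    by split=> -[]; lia.
  - by split=> -[]; lia.
  - have := perL _ h; case: q => [|q]; first by rewrite !addn0; tauto.
    by split=> -[]; lia.
  by split=> -[]; lia.
have perR : periodic D R.
  have pull x' k : c x' = k + D -> D <= k -> exists x, c x = k /\
     ((f x' = f x /\ c (f x) < D) \/ (c (f x') = c (f x) + D /\ c x < c (f x) + D)).
    move=> Ex' h; have [|x Ex] := T3 x'; first lia.
    have Ek : c x = k by lia.
    have [|x1 [E1 H]] := T2 x; first lia.
    by exists x; split=> //; have -> : x' = x1 by apply: c_inj; lia.
  split=> p q; split=> h; split.
  - move=> [x [E1 E2]]; have [|x' [E' [[? ?]|[? ?]]]] := T2 x; try lia.
    by exists x'; lia.
  - move=> [x' [E1 E2]]; have [||x [E' [[? ?]|[? ?]]]] := pull x' (p + q); try lia.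
      by rewrite (_ : f x' = f x) // in E2; lia.
    by exists x; lia.
  - move=> [x [E1 E2]]; have [|x' [E' [[Ef ?]|[? ?]]]] := T2 x; try lia.
    by exists x'; rewrite Ef; lia.
  - move=> [x' [E1 E2]]; have [||x [E' [[Ef ?]|[? ?]]]] := pull x' (p + q); try lia.
    by exists x; rewrite -Ef.
  - move=> [x [E1 E2]]; have [|x' [E' [[? ?]|[? ?]]]] := T2 x; try lia.
    by exists x'; lia.
  - move=> [x' [E1 E2]]; have [||x [E' [[Ef ?]|[? ?]]]] := pull x' p; try lia.
      by rewrite Ef in E2; lia.
    by exists x; lia.
  (* A tail of length [D] on the second track never occurs, since [f] raises the code by less than
     [D]. *)
  - by move=> [x [E1 E2]]; have := T1 x; lia.
  by move=> [x [E1 E2]]; have := T1 x; lia.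
exists L, phi; split; [by move=> x; exists (c x); split=> //; exists x|split; [|split]].
- by apply: regular_diagonal; apply: periodic_regular perQ.
- apply: regular_eq (periodic_regular D_gt0 perQ) => w; split.
    by move=> [m [n [[Lm <-] ->]]]; exists m, m.
  move=> [m [n [[x <-] [y <-]]]]; rewrite !phiP => -> ->.
  by exists (c y), (c y); split=> //; split=> //; exists y.
apply: regular_eq (periodic_regular D_gt0 perR) => w; split.
  move=> [m [n [[x [<- <-]] ->]]]; exists (c x), (c (f x)); split=> //.
  - by exists x.
  - by exists (f x).
  by rewrite !phiP.
move=> [m [n [[x <-] [y <-]]]]; rewrite !phiP => Ey ->.
by exists (c x), (c y); split=> //; exists x; rewrite Ey.
Qed.

(** The finite points are numbered first, then the rungs level by level, so that going up [K] levels
    adds the constant [b * K] to the code. [K] only has to pass finitely many thresholds. *)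
Lemma ladders_presentable (X : Type) (f : X -> X) :
  inhabited X -> ladders (map_graph f) -> unary_FA_presentable f.
Proof.
move=> X0 [F I eF e e_inj cover step].
have [Y [h [h_inj hP]]] := finite_range_enum eF (fun x => ~ exists i j, x = e i j).
have hne y i j : h y <> e i j.
  by move=> E; case: ((hP (h y)).1 (ex_intro _ y erefl)) => _; apply; exists i, j.
have {}cover x : (exists y, x = h y) \/ (exists i j, x = e i j).
  case: (classic (exists i j, x = e i j)) => [|n]; first by right.
  by left; apply/hP; split=> //; case: (cover x).
pose a := #|Y|; pose b := #|I|.
have [c [ch ce]] : exists c : X -> nat, (forall y, c (h y) = enum_rank y) /\
    (forall i j, c (e i j) = a + j * b + enum_rank i).
  pose code x n := (forall y, x = h y -> n = enum_rank y :> nat) /\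
                   (forall i j, x = e i j -> n = a + j * b + enum_rank i).
  have H x : exists n, code x n.
    case: (cover x) => [[y ->]|[i [j ->]]].
      exists (enum_rank y); split; first by move=> z /h_inj ->.
      by move=> i j /hne.
    exists (a + j * b + enum_rank i); split; first by move=> y /esym /hne.
    by move=> i' j' /e_inj[-> ->].
  exists (fun x => proj1_sig (constructive_indefinite_description _ (H x))).
  by split=> [y|i j]; case: constructive_indefinite_description => n /= [h1 h2]; auto.
have rkY (y : Y) : enum_rank y < a := ltn_ord _.
have rkI (i : I) : enum_rank i < b := ltn_ord _.
have c_inj : injective c.
  move=> x x'; case: (cover x) => [[y ->]|[i [j ->]]];
  case: (cover x') => [[y' ->]|[i' [j' ->]]]; rewrite ?ch ?ce.
  - by move=> E; congr h; apply: enum_rank_inj; apply: val_inj.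
  - by have := rkY y; lia.
  - by have := rkY y'; lia.
  rewrite -!addnA => /addnI E.
  have b_gt0 : 0 < b by have := rkI i; lia.
  have Ej : j = j'.
    have := congr1 (divn^~ b) E; rewrite /= !divnMDl //.
    by rewrite !divn_small // !addn0.
  by move: E; rewrite Ej => /addnI E; congr e; apply: enum_rank_inj; apply: val_inj.
have [K1 HK1] := fin_bound (fun y => c (f (h y))).
(* [n] is the number of levels shifted; [n <= j + a + 1] is what a code of at least [b * n]
   guarantees. *)
have : exists K, forall i n, K <= n ->
    (forall j, c (f (e i j)) < c (e i j) + b * n) /\
    (forall j, n <= j + a + 1 ->
       (f (e i (j + n)) = f (e i j) /\ c (f (e i j)) < b * n) \/
       (c (f (e i (j + n))) = c (f (e i j)) + b * n /\
        c (e i j) < c (f (e i j)) + b * n)).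
  apply: fin_bound_ex => i; have b_gt0 : 0 < b by have := rkI i; lia.
  have bn n : n <= b * n by rewrite leq_pmull.
  case: (step i) => [[x [s Hx]]|[i' [s [t Hi']]]].
    have [K0 HK0] := fin_bound (fun j : 'I_s => c (f (e i j))).
    exists (K0 + c x + s + a + 1 + 1) => n hn; have := bn n; split=> j.
      case: (ltnP j s) => hj; first by have /= := HK0 (Ordinal hj); lia.
      by rewrite -[in f _](subnK hj) Hx; lia.
    move=> hj; left; have hs : s <= j by lia.
    have -> : e i (j + n) = e i (j + n - s + s) by rewrite subnK //; lia.
    have -> : e i j = e i (j - s + s) by rewrite subnK.
    by rewrite !Hx; split=> //; lia.
  have [K0 HK0] := fin_bound (fun j : 'I_s => c (f (e i j))).
  exists (K0 + s + t + a + 1 + 1) => n hn; have := bn n; split=> j.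
    case: (ltnP j s) => hj; first by have /= := HK0 (Ordinal hj); lia.
    have -> : f (e i j) = e i' (j - s + t) by rewrite -Hi' subnK.
    rewrite !ce; have := rkI i'; have : (j - s + t).+1 <= j + n by lia.
    by rewrite -(leq_pmul2r b_gt0); lia.
  move=> hj; right; have hs : s <= j by lia.
  have -> : f (e i (j + n)) = e i' (j + n - s + t) by rewrite -Hi' subnK //; lia.
  have -> : f (e i j) = e i' (j - s + t) by rewrite -Hi' subnK.
  rewrite !ce; have -> : j + n - s + t = j - s + t + n by lia.
  split; first lia.
  have := rkI i; have : j.+1 <= j - s + t + n by lia.
  by rewrite -(leq_pmul2r b_gt0); lia.
move=> [K2 HK2].
(* [b'] keeps [D] positive when there are no ladders. *)
pose K := K1 + K2 + a + 1; pose b' := maxn 1 b; pose D := b' * K.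
have D_ge : K <= D by rewrite leq_pmull // /b'; lia.
have DE (i : I) : D = b * K by rewrite /D /b'; have := rkI i; case: (b) => // *; congr muln; lia.
have large x n : n * D <= c x -> 0 < n -> exists i j, x = e i j /\ n * K <= j + a + 1.
  case: (cover x) => [[y ->]|[i [j ->]]].
    by rewrite ch; have := rkY y; case: n => // n; nia.
  rewrite ce (DE i) => hn _; exists i, j; split=> //.
  have b_gt0 : 0 < b by have := rkI i; lia.
  rewrite -(leq_pmul2r b_gt0); have := rkI i; nia.
apply: (@code_presentable _ _ c D) => //; first lia.
- move=> x; case: (cover x) => [[y ->]|[i [j ->]]].
    by have := HK1 y; lia.
  by rewrite (DE i); apply: (HK2 i K _).1; lia.
- move=> x hx; have [||i [j [-> hj]]] := large x 1; [lia|lia|].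
  exists (e i (j + K)); rewrite (DE i); split; first by rewrite !ce; lia.
  by apply: (HK2 i K _).2; lia.
move=> x hx; have [||i [j [-> hj]]] := large x 2; [lia|lia|].
exists (e i (j - K)); rewrite (DE i) !ce.
by rewrite -[in LHS](@subnK K j); lia.
Qed.

(** * Rooted trees as parent functions *)

(** An inward tree as a map to iterate, with the root made a fixed point. Later constructions handle
    trees only in this form. *)
Definition parent_of (T : finType) (e : rel T) (t : T) (par : T -> T) : Prop :=
  [/\ par t = t, forall x, exists n, iter n par x = t
    & forall x y, e x y = (x != t) && (y == par x)].

Section ParentTree.
Variables (T : finType) (e : rel T) (t : T) (par : T -> T).
Hypothesis Hpar : parent_of e t par.

Definition below (y v : T) : Prop := exists n, iter n par y = v.

Lemma iter_root n : iter n par t = t.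
Proof. by case: Hpar => pt _ _; elim: n => //= n ->. Qed.

Lemma not_below_par x : x != t -> ~ below (par x) x.
Proof.
case: Hpar => pt reach _ xt [n En].
have per k : iter (k * n.+1) par x = x.
  by elim: k => // k IH; rewrite mulSn addnC iterD iterSr En.
have [m Em] := reach x; case/negP: xt; apply/eqP.
rewrite -[LHS](per m) mulnS addnC iterD.
by rewrite Em iter_root.
Qed.

(** The descendants of [v] are joined to the other vertices only through [v], which traps a simple
    path on one side. *)
Lemma adj_enter v a b : adj e a b -> ~ below a v -> below b v -> b = v.
Proof.
case: Hpar => _ _ eE /orP[]; rewrite eE => /andP[_ /eqP ->] na [n En].
  by case: na; exists n.+1; rewrite iterSr.
by case: n En => // n; rewrite iterSr => En; case: na; exists n.
Qed.

Lemma adj_sym : symmetric (adj e).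
Proof. by move=> x y; rewrite /adj orbC. Qed.

Lemma path_stay_out v p a :
  path (adj e) a p -> ~ below a v -> v \notin p -> ~ below (last a p) v.
Proof.
elim: p a => //= b p IH a /andP[ab bp] na; rewrite inE negb_or => /andP[vb vp].
apply: IH => // bv; case/negP: vb; apply/eqP; symmetry.
exact: adj_enter ab na bv.
Qed.

Lemma path_stay_in v p a : path (adj e) a p -> below a v ->
  par v \notin p -> below (last a p) v.
Proof.
case: Hpar => _ _ eE.
elim: p a => //= b p IH a /andP[ab bp] ina; rewrite inE negb_or => /andP[vb vp].
apply: IH => //; apply: NNPP => nb.
rewrite adj_sym in ab; have Ea := adj_enter ab nb ina; subst a.
move: ab; rewrite /adj !eE => /orP[]/andP[_ /eqP E].
  by case: nb; exists 1; rewrite /= -E.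
by rewrite E eqxx in vb.
Qed.

Lemma child_inj c c' y : c != t -> c' != t -> par c = par c' ->
  below y c -> below y c' -> c = c'.
Proof.
have wl a b n m : n <= m -> b != t -> par a = par b ->
    iter n par y = a -> iter m par y = b -> a = b.
  move=> nm bt ab Ea Eb; have := subnK nm; case: (m - n) => [|k] Ek.
    by rewrite -Ea -Eb -Ek.
  case: (not_below_par bt); exists k.
  by rewrite -ab -Ea -iterS -iterD -Eb -Ek addnS.
move=> ct ct' E [n En] [m Em]; case: (leqP n m) => nm.
  exact: wl nm ct' E En Em.
by symmetry; apply: wl (ltnW nm) ct (esym E) Em En.
Qed.

Lemma spath_first_up x p y : x != t -> spath (adj e) x (par x :: p) y -> ~ below y x.
Proof.
move=> xt /and3P[/= /andP[_ pp] /eqP <- /andP[]]; rewrite inE negb_or => /andP[_ xp] _.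
exact: path_stay_out pp (not_below_par xt) xp.
Qed.

Lemma spath_first_down x c p y : c != t -> x = par c ->
  spath (adj e) x (c :: p) y -> below y c.
Proof.
move=> ct Ex /and3P[/= /andP[_ pp] /eqP <- /andP[]]; rewrite inE negb_or => /andP[_ xp] _.
by apply: path_stay_in pp _ _; [exists 0|rewrite -Ex].
Qed.

Lemma spath_cons x c p y : spath (adj e) x (c :: p) y -> spath (adj e) c p y.
Proof. by move=> /and3P[/= /andP[_ pp] yl /andP[_ u]]; apply/and3P. Qed.

(** The first steps agree: a step up from [x] means that [y] is not below [x], a step down to [c]
    means that [y] is below [c], and distinct children of [x] have no common descendant. *)
Lemma spath_uniq x y p p' : spath (adj e) x p y -> spath (adj e) x p' y -> p = p'.
Proof.
case: Hpar => _ _ eE.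
have loop z q c : ~ spath (adj e) z (c :: q) z.
  move=> /and3P[/= _ /eqP E /andP[]]; rewrite -E mem_last //.
elim: p p' x => [|c p IH] [|c' p'] x //.
- by move=> /and3P[_ /eqP /= <- _] /loop.
- by move=> h /and3P[_ /eqP /= E _]; rewrite -E in h; case: (loop _ _ _ h).
move=> h h'; suff E : c = c'.
  by rewrite -E in h' *; congr cons; apply: (IH _ c); apply: spath_cons; eassumption.
have /and3P[/= /andP[] ] := h; have /and3P[/= /andP[] ] := h'.
rewrite /adj !eE => /orP[]/andP[t1 /eqP E1] _ _ _ /orP[]/andP[t2 /eqP E2] _ _ _.
- by rewrite E1 E2.
- case: (spath_first_up t1 (p := p') (y := y)); first by rewrite -E1.
  have [n En] := spath_first_down t2 E2 h.
  by exists n.+1; rewrite iterS En E2.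
- case: (spath_first_up t2 (p := p) (y := y)); first by rewrite -E2.
  have [n En] := spath_first_down t1 E1 h'.
  by exists n.+1; rewrite iterS En E1.
apply: (@child_inj c c' y) => //; first by rewrite -E2.
  exact: spath_first_down h.
exact: spath_first_down h'.
Qed.

Lemma parent_dtree : dtree e.
Proof.
case: Hpar => pt reach eE.
have adj_irr x : x != t -> x != par x.
  by move=> xt; apply/negP => /eqP E; apply: (not_below_par xt); exists 0; rewrite /= -E.
split=> [x|x y|x y].
- by rewrite eE; apply/negP => /andP[/adj_irr/negP].
- rewrite !eE => /andP[xt /eqP ->]; apply/negP => /andP[_ /eqP E].
  by apply: (not_below_par xt); exists 1; rewrite /= -E.
have toroot z : connect (adj e) z t.
  have [n] := reach z; elim: n z => [|n IH] z; first by move=> /= ->.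
  rewrite iterSr => /IH h; case: (eqVneq z t) => [->//|zt].
  by apply: connect_trans h; apply: connect1; rewrite /adj eE zt eqxx.
have : connect (adj e) x y.
  by apply: connect_trans (toroot x) _; rewrite (sym_connect_sym adj_sym) toroot.
move=> /connectP[p pp Ey]; case: (shortenP pp) Ey => p' pp' u _ Ey.
have sp : spath (adj e) x p' y by apply/and3P; split=> //; rewrite Ey.
by exists p'; split=> // p2; apply: spath_uniq.
Qed.

Lemma parent_oriented : oriented_towards e t.
Proof.
case: Hpar => pt reach eE u v; rewrite eE => /andP[ut /eqP Ev] [|c p] h.
  by case/and3P: h => /= _ /eqP E; rewrite E eqxx in ut.
have /and3P[/= /andP[]] := h; rewrite /adj !eE => /orP[]/andP[ct /eqP E] _ _ _.
  by rewrite Ev E mem_head.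
have [n] := spath_first_down ct E h.
by rewrite iter_root => Et; rewrite Et eqxx in ct.
Qed.

End ParentTree.

(** By orientation the path from [x] to [t] must start along an outgoing edge, and this is the only
    one leaving [x]. *)
Lemma dtree_parent (T : finType) (e : rel T) (t : T) :
  dtree e -> oriented_towards e t -> exists par, parent_of e t par.
Proof.
move=> [irr asym upath] orient.
have out x : x != t -> exists y, [/\ e x y, forall z, e x z -> z = y
    & forall p, spath (adj e) x p t -> exists2 p', p = y :: p' & spath (adj e) y p' t].
  move=> xt; have [[|y p] [sp unq]] := upath x t.
    by case/and3P: sp => _ /= /eqP E; rewrite E eqxx in xt.
  have sp' := spath_cons sp.
  have xp : x \notin y :: p by case/and3P: sp => _ _ /= /andP[].
  have exy : e x y.
    have /and3P[/= /andP[/orP[//|yx] _] _ _] := sp.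
    by case/negP: xp; rewrite inE (orient _ _ yx _ sp') orbT.
  exists y; split=> // [z exz|p2 sp2]; last by rewrite -(unq _ sp2); exists p.
  (* [z] lies on the path to [t]. The segment of the path up to [z] and the edge itself are simple
     paths with the same ends, hence equal. *)
  have := orient _ _ exz _ sp; rewrite inE => /orP[/eqP //|zp].
  have [q [sq uq]] := upath x z.
  have E1 : q = [:: z].
    apply: uq; apply/and3P; split; rewrite //= ?andbT; first by rewrite /adj exz.
    by rewrite inE; apply/negP => /eqP E; have := irr x; rewrite {2}E exz.
  case/splitPr: zp sp {unq sp' xp} => p1 p2 sp.
  have : q = y :: rcons p1 z.
    apply: uq; case/and3P: sp => pp _ u.
    rewrite -cat_rcons -cat_cons cat_path in pp; case/andP: pp => pp _.
    apply/and3P; split=> //; first by rewrite /= last_rcons.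
    by move: u; rewrite -cat_rcons -!cat_cons cat_uniq => /andP[].
  by rewrite E1; case: p1 {sp}.
pose par x := if x == t then t else odflt t [pick y | e x y].
have parE x : x != t -> e x (par x).
  move=> xt; rewrite /par (negPf xt); case: pickP => //= none.
  by have [y [exy _ _]] := out x xt; rewrite none in exy.
exists par; split=> [|x|x y].
- by rewrite /par eqxx.
- have [p [sp _]] := upath x t; elim: p x sp => [|c p IH] x sp.
    by exists 0; case/and3P: sp => _ /eqP.
  case: (eqVneq x t) => [->|xt]; first by exists 0.
  have [y [_ unq H]] := out x xt; have [p' [_ Ep] sp'] := H _ sp.
  rewrite -Ep in sp'; have [n En] := IH _ sp'.
  by exists n.+1; rewrite iterSr (unq _ (parE _ xt)).
apply/idP/andP => [exy|[xt /eqP ->]]; last exact: parE.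
have xt : x != t.
  apply/negP => /eqP E; rewrite E in exy.
  by have := orient _ _ exy [::]; rewrite /spath /= eqxx => /(_ isT).
split=> //; have [z [_ unq _]] := out x xt.
by rewrite (unq _ exy) (unq _ (parE _ xt)).
Qed.

(** * Ladders of the obtainable graphs *)

(** Rungs of an attached graph avoid its attachment point, so gluing never merges two rungs and the
    ladders of the parts can be collected. *)
Lemma glued_ladders (B : graph) (k : nat) (H : 'I_k -> graph)
    (h : forall i, vtx (H i)) (g : 'I_k -> vtx B) (G : graph) :
  inhabited (ladders B) ->
  (forall i, exists l : ladders (H i), forall a j, rung l a j <> h i) ->
  glued B k H h g G -> inhabited (ladders G).
Proof.
move=> [lB] HH [iB [iH [[iB_inj iH_inj base iHB iHH] [cover edgeE]]]].
pose l i := proj1_sig (constructive_indefinite_description _ (HH i)).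
have lP i : forall a j, rung (l i) a j <> h i := proj2_sig (constructive_indefinite_description _ (HH i)).
pose F : finType := (lfin lB + {i : 'I_k & lfin (l i)})%type.
pose I : finType := (lidx lB + {i : 'I_k & lidx (l i)})%type.
pose pt (y : F) := match y with
  | inl y => iB (lpt y) | inr y => iH (tag y) (lpt (tagged y)) end.
pose e (a : I) j := match a with
  | inl a => iB (rung lB a j) | inr a => iH (tag a) (rung (l (tag a)) (tagged a) j) end.
split; apply: (@Ladders G F I pt e).
- move=> [a|[i a]] j [a'|[i' a']] j' /=.
  + by move=> /iB_inj/rung_inj[-> ->].
  + by move=> /esym/iHB /lP.
  + by move=> /iHB /lP.
  move=> E; case: (eqVneq i i') => [Ei|/eqP ii']; last by have [/lP] := iHH _ _ _ _ ii' E.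
  by move: a E; rewrite Ei => a /iH_inj/rung_inj[-> ->].
- move=> v; case: (cover v) => [[y ->]|[i [x ->]]].
    case: (ladders_cover lB y) => [[z ->]|[a [j ->]]]; first by left; exists (inl z).
    by right; exists (inl a), j.
  case: (ladders_cover (l i) x) => [[z ->]|[a [j ->]]].
    by left; exists (inr (Tagged (fun i => lfin (l i)) z)).
  by right; exists (inr (Tagged (fun i => lidx (l i)) a)), j.
move=> [a|[i a]] /=.
  case: (rung_edge lB a) => [[x [s Hx]]|[a' [s [t Ha]]]].
    by left; exists (iB x), s => j; apply/edgeE; left; exists (rung lB a (j + s)), x.
  right; exists (inl a'), s, t => j; apply/edgeE; left.
  by exists (rung lB a (j + s)), (rung lB a' (j + t)).
case: (rung_edge (l i) a) => [[x [s Hx]]|[a' [s [t Ha]]]].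
  left; exists (iH i x), s => j; apply/edgeE; right.
  by exists i, (rung (l i) a (j + s)), x.
right; exists (inr (Tagged (fun i => lidx (l i)) a')), s, t => j; apply/edgeE; right.
by exists i, (rung (l i) a (j + s)), (rung (l i) a' (j + t)).
Qed.

Lemma finite_ladders (T : finType) (E : T -> T -> Prop) :
  exists l : ladders (@Graph T E), forall a : lidx l, False.
Proof.
have inj (i : void) (j : nat) (i' : void) (j' : nat) :
    of_void T i = of_void T i' -> i = i' /\ j = j' by case: i.
have cover (x : T) : (exists y, x = id y) \/ (exists i (j : nat), x = of_void T i).
  by left; exists x.
have step (i : void) : (exists x (a : nat), forall j : nat, E (of_void T i) x) \/
    (exists i' (a b : nat), forall j : nat, E (of_void T i) (of_void T i')) by case: i.
by exists (@Ladders (@Graph T E) T void id (fun i _ => of_void T i) inj cover step) => -[].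
Qed.

Section TemplateLadders.
Variable P : template.
Definition tail_idx : finType := {u : tT P | u != t0 P}.

Definition tail (u : tail_idx) (j : nat) : vtx (Sgraph P) :=
  exist (@Svalid P) (Some (j, val u)) (valP u).

Lemma tail_Srep (u : tail_idx) j : val (tail u j) = Srep j (val u).
Proof. by rewrite /Srep (negPf (valP u)). Qed.

Lemma template_ladders :
  (forall u, (exists x a, forall j, edge (tail u (j + a)) x) \/
    (exists u' a b, forall j, edge (tail u (j + a)) (tail u' (j + b)))) ->
  exists l : ladders (Sgraph P), forall a j, rung l a j <> Sbase P.
Proof.
move=> H; unshelve eexists (@Ladders (Sgraph P) unit tail_idx (fun=> Sbase P) tail _ _ H).
- by move=> u j u' j' [-> E]; split=> //; apply: val_inj.
- move=> [[[j u]|] h]; last by left; exists tt; apply: val_inj.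
  by right; exists (exist _ u h), j; apply: val_inj.
by move=> u j [].
Qed.

Lemma par_neq (e : rel (tT P)) t par x : parent_of e t par -> x != t -> par x != x.
Proof.
move=> Hp xt; apply/negP => /eqP E.
by apply: (not_below_par Hp xt); exists 0.
Qed.

(** An edge stays in its copy unless it ends at [t0], which is [t1] of the preceding copy for a path
    and the centre for a star. *)
Lemma inward_ladders : inward_template P ->
  exists l : ladders (Sgraph P), forall a j, rung l a j <> Sbase P.
Proof.
move=> [[tree _] orient]; have [par Hpar] := dtree_parent tree orient.
have [_ _ eE] := Hpar; apply: template_ladders => u.
have eu : te P (val u) (par (val u)) by rewrite eE (valP u) eqxx.
case: (boolP (par (val u) == t0 P)) => [/eqP pu|pu]; last first.
  right; exists (Sub (par (val u)) pu), 0, 0 => j; exists (j + 0), (val u), (par (val u)).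
  by rewrite !tail_Srep.
case: (boolP (t1 P == t0 P)) => [/eqP t10|t10].
  left; exists (Sbase P), 0 => j; exists (j + 0), (val u), (par (val u)).
  split=> //; first by rewrite tail_Srep.
  by rewrite pu /Srep eqxx t10 eqxx; case: (j + 0).
right; exists (Sub (t1 P) t10), 1, 0 => j; exists (j + 1), (val u), (par (val u)).
split=> //; first by rewrite tail_Srep.
by rewrite pu /Srep eqxx addn1 eq_sym t10 /= addn0.
Qed.

(** The tree is rooted at [t1], whose outgoing edge lies in the next copy, where it plays the role
    of [t0]; this is the climb by one level. *)
Lemma outward_ladders : outward_path P ->
  exists l : ladders (Sgraph P), forall a j, rung l a j <> Sbase P.
Proof.
move=> [[tree _] /eqP t01 orient]; have [par Hpar] := dtree_parent tree orient.
have [_ _ eE] := Hpar; apply: template_ladders => u.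
case: (eqVneq (val u) (t1 P)) => [ut|ut].
  have p0 : par (t0 P) != t0 P by apply: par_neq Hpar t01.
  right; exists (Sub (par (t0 P)) p0), 0, 1 => j; exists (j + 1), (t0 P), (par (t0 P)).
  split; first by rewrite eE t01 eqxx.
    by rewrite /= /Srep eqxx addn1 t01 addn0 ut.
  by rewrite tail_Srep.
have eu : te P (val u) (par (val u)) by rewrite eE ut eqxx.
case: (boolP (par (val u) == t0 P)) => [/eqP pu|pu]; last first.
  right; exists (Sub (par (val u)) pu), 0, 0 => j; exists (j + 0), (val u), (par (val u)).
  by rewrite !tail_Srep.
have t10 : t1 P != t0 P by rewrite eq_sym.
right; exists (Sub (t1 P) t10), 1, 0 => j; exists (j + 1), (val u), (par (val u)).
split=> //; first by rewrite tail_Srep.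
by rewrite pu /Srep eqxx addn1 eq_sym t10 /= addn0.
Qed.
End TemplateLadders.

Lemma attach_inward_ladders (B G : graph) :
  inhabited (ladders B) -> attach_inward B G -> inhabited (ladders G).
Proof.
move=> lB [m [P [g [HP]]]]; apply: glued_ladders lB _ => i.
exact: inward_ladders.
Qed.

Lemma obtainable1_ladders (G : graph) : obtainable1 G -> inhabited (ladders G).
Proof.
move=> [n [k [R [g [B1 [_ _ gl att]]]]]]; apply: attach_inward_ladders att.
apply: glued_ladders gl => [|i]; last first.
  by have [l Hl] := finite_ladders (fun x y : rT (R i) => re (R i) x y); exists l => a; case: (Hl a).
by have [l _] := finite_ladders (fun i j : 'I_n => val j = (val i).+1 %% n); exists.
Qed.

Lemma obtainable2_ladders (G : graph) : obtainable2 G -> inhabited (ladders G).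
Proof.
move=> [R [P [B1 [_ HP gl att]]]]; apply: attach_inward_ladders att.
apply: glued_ladders gl => [|i]; last exact: outward_ladders.
by have [l _] := finite_ladders (fun x y : rT R => re R x y); exists.
Qed.

(** * Straightening the ladders of a map with a single orbit *)

(* A minimal set met by all forward [q]-orbits contains exactly one point of
   each cycle of [q]. *)
Lemma cycle_transversal (I : finType) (q : I -> I) : exists C : pred I,
  (forall i, exists n, C (iter n q i)) /\
  (forall r n, C r -> C (iter n q r) -> iter n q r = r).
Proof.
pose P (A : {set I}) := [forall i, [exists a in A, fconnect q i a]].
have [A /minsetP[PA minA]] : {A | minset P A}.
  apply: ex_minset; exists setT; apply/forallP => i; apply/existsP; exists i.
  by rewrite inE connect0.
exists (mem A); split=> [i|r n /= rA sA].
  have /existsP[a /andP[aA ia]] := forallP PA i.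
  by exists (findex q i a); rewrite /= iter_findex.
apply: NNPP => /eqP ne.
have PB : P (A :\ r).
  apply/forallP => i; have /existsP[a /andP[aA ia]] := forallP PA i.
  apply/existsP; case: (eqVneq a r) => [Ea|ar]; last by exists a; rewrite !inE ar aA.
  exists (iter n q r); rewrite !inE ne sA /=; apply: connect_trans ia _.
  by rewrite Ea fconnect_iter.
by have := minA _ PB (subD1set _ _); move/setP/(_ r); rewrite !inE eqxx rA.
Qed.

Definition stop_at (I : Type) (C : pred I) (q : I -> I) (i : I) : I :=
  if C i then i else q i.

Lemma stop_at_reach (I : finType) (C : pred I) (q : I -> I) :
  (forall i, exists n, C (iter n q i)) -> exists N, forall i, C (iter N (stop_at C q) i).
Proof.
move=> reach; pose p := stop_at C q.
have Cp n i : C i -> iter n p i = i by move=> Ci; elim: n => //= n ->; rewrite /p /stop_at Ci.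
have reachp n i : C (iter n q i) -> C (iter n p i).
  elim: n i => // n IH i; rewrite !iterSr => /IH h.
  have -> : p i = if C i then i else q i by [].
  by case: ifP => // Ci; rewrite Cp.
have [N HN] : exists N, forall i n, N <= n -> C (iter n p i).
  apply: fin_bound_ex => i; have [m /reachp Cm] := reach i.
  by exists m => n mn; rewrite -(subnK mn) iterD Cp.
by exists N => i; apply: HN.
Qed.

(** Stopping at the transversal makes its points the roots. The edge cut at a root leads back into
    its own tree, because the next chosen point after [r] is [r] again. *)
Lemma cut_cycles (I : finType) (q : I -> I) : exists (p : I -> I) (N : nat),
  [/\ forall i, p (iter N p i) = iter N p i,
      forall i, p i <> i -> p i = q i
    & forall r, p r = r -> iter N p (q r) = r].
Proof.
have [C [reach uniqC]] := cycle_transversal q.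
have [N HN] := stop_at_reach reach; pose p := stop_at C q.
(* A fixed point of [p] outside [C] would be fixed by [q] and never reach [C]. *)
have pC i : p i = i -> C i.
  rewrite /p /stop_at; case: ifP => // Ci E; have [n] := reach i.
  have -> : iter n q i = i by elim: n => //= n ->.
  by rewrite Ci.
exists p, N; split=> [i|i|r /pC Cr].
- by rewrite {1}/p /stop_at HN.
- by rewrite /p /stop_at; case: ifP.
have itq n i : exists m, iter n p i = iter m q i.
  elim: n => [|n [m Em]]; first by exists 0.
  rewrite iterS Em {1}/p /stop_at; case: ifP => _; first by exists m.
  by exists m.+1.
have [m Em] := itq N (q r).
have := HN (q r); rewrite -/p Em -iterSr.
exact: uniqC.
Qed.

(* The index set is a forest whose roots are the fixed points of [par]; the
   root of [i] is [iter height par i]. *)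
Record straight_ladders (X : Type) (f : X -> X) := StraightLadders {
  sfin : finType;
  sidx : finType;
  spt : sfin -> X;
  srung : sidx -> nat -> X;
  par : sidx -> sidx;
  height : nat;
  srung_inj : forall i j i' j', srung i j = srung i' j' -> i = i' /\ j = j';
  scover : forall x, (exists y, x = spt y) \/ (exists i j, x = srung i j);
  par_root : forall i, par (iter height par i) = iter height par i;
  srung_step : forall i j, par i <> i -> f (srung i j) = srung (par i) j;
  srung_root : forall r, par r = r ->
    (exists x, forall j, f (srung r j) = x) \/
    (exists t, iter height par t = r /\
      ((exists2 d, 0 < d & forall j, f (srung r (j + d)) = srung t j) \/
       (exists d, forall j, f (srung r j) = srung t (j + d)))) }.

Lemma ladders_straighten (X : Type) (f : X -> X) :
  ladders (map_graph f) -> inhabited (straight_ladders f).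
Proof.
move=> [F I pt e e_inj cover step].
have [h Hh] : exists h : I -> I * nat * nat, forall i,
    let: (q, a, b) := h i in
    (q = i /\ exists x, forall j, f (e i (j + a)) = x) \/
    (forall j, f (e i (j + a)) = e q (j + b)).
  have H i : exists h : I * nat * nat, let: (q, a, b) := h in
      (q = i /\ exists x, forall j, f (e i (j + a)) = x) \/
      (forall j, f (e i (j + a)) = e q (j + b)).
    case: (step i) => [[x [a Hx]]|[q [a [b Hq]]]]; last by exists (q, a, b); right.
    by exists (i, a, 0); left; split=> //; exists x.
  by have [choice_f ?] := fun_choice H; exists choice_f.
pose q i := (h i).1.1; pose a i := (h i).1.2; pose b i := (h i).2.
have {}Hh i : (q i = i /\ exists x, forall j, f (e i (j + a i)) = x) \/
    (forall j, f (e i (j + a i)) = e (q i) (j + b i)).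
  by have := Hh i; rewrite /q /a /b; case: (h i) => [[]].
have [p [N [pN pq proot]]] := cut_cycles q.
(* The total of [c] on the way from [i] to its root; [N] steps suffice and the root contributes
   nothing. *)
pose sum (c : I -> nat) i := \sum_(k < N) if p (iter k p i) == iter k p i then 0 else c (iter k p i).
have sumE c i : p i <> i -> sum c i = c i + sum c (p i).
  move=> pi; rewrite /sum.
  have -> : \sum_(k < N) (if p (iter k p i) == iter k p i then 0 else c (iter k p i)) =
            \sum_(k < N.+1) (if p (iter k p i) == iter k p i then 0 else c (iter k p i)).
    by rewrite big_ord_recr /= pN eqxx addn0.
  rewrite big_ord_recl /=; case: eqP => // _; congr (_ + _).
  by apply: eq_bigr => k _; rewrite -iterSr.
(* The margin [a i] makes the edge rule valid from level 0 of the realigned sequence. *)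
have [W HW] := fin_bound (fun i => sum b i + a i).
(* The offset [w i] realigns the sequences so that [f] preserves levels off the roots. *)
pose w i := W + sum a i - sum b i.
have wa i : a i <= w i by have /= := HW i; rewrite /w; lia.
have ww i : p i <> i -> w (p i) + a i = w i + b i.
  move=> pi; have := sumE a i pi; have := sumE b i pi.
  by have /= := HW i; have /= := HW (p i); rewrite /w; lia.
pose e1 i j := e i (j + w i).
pose F1 : finType := (F + {i : I & 'I_(w i)})%type.
pose pt1 (y : F1) := match y with inl y => pt y | inr y => e (tag y) (tagged y) end.
split; apply: (@StraightLadders X f F1 I pt1 e1 p N) => //.
- by move=> i j i' j' /e_inj[-> E]; split=> //; apply: addIn E.
- move=> x; case: (cover x) => [[y ->]|[i [j ->]]]; first by left; exists (inl y).
  case: (ltnP j (w i)) => hj.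
    by left; exists (inr (Tagged (fun i => 'I_(w i)) (Ordinal hj))).
  by right; exists i, (j - w i); rewrite /e1 subnK.
- move=> i j pi; rewrite /e1; have Eq := pq i pi.
  case: (Hh i) => [[E _]|H]; first by rewrite Eq in pi.
  have -> : j + w i = j + (w i - a i) + a i by have := wa i; lia.
  rewrite H -Eq; congr e; have := ww i pi; have := wa i; lia.
move=> r pr; have Er j : e1 r j = e r (j + (w r - a r) + a r).
  by rewrite /e1; congr e; have := wa r; lia.
case: (Hh r) => [[_ [x Hx]]|H]; first by left; exists x => j; rewrite Er.
right; exists (q r); split; first exact: proot.
case: (leqP (w (q r)) (w r - a r + b r)) => h1; [right|left].
  by exists (w r - a r + b r - w (q r)) => j; rewrite Er H /e1; congr e; lia.
exists (w (q r) - (w r - a r + b r)); first by lia.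
by move=> j; rewrite Er H /e1; congr e; lia.
Qed.

(** * Uniqueness of the ascending root *)

Lemma iter_par_root (I : Type) (p : I -> I) N :
  (forall i, p (iter N p i) = iter N p i) -> forall i, iter N p (p i) = iter N p i.
Proof. by move=> H i; rewrite -iterSr iterS. Qed.

(** Only the step out of the root changes the level, by [d], and it returns to the same tree; tree
    and residue are invariants of the forward orbit. *)
Lemma ascent_orbit (X : Type) (f : X -> X) (s : straight_ladders f) r t d n i j :
  par r = r -> iter (height s) (@par _ _ s) t = r ->
  (forall j, f (srung r j) = srung t (j + d)) ->
  iter (height s) (@par _ _ s) i = r ->
  exists i' j', [/\ iter n f (srung i j) = srung i' j',
    iter (height s) (@par _ _ s) i' = r & j' = j %[mod d]].
Proof.
move=> pr tr Hr ir; elim: n => [|n [i' [j' [E i'r j'd]]]]; first by exists i, j.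
rewrite iterS E; case: (classic (par i' = i')) => [pi|pi].
  have Ei : i' = r by rewrite -i'r; elim: (height s) => //= k <-.
  exists t, (j' + d); split=> //; first by rewrite Ei.
  by rewrite modnDr.
exists (par i'), j'; split=> //; first exact: srung_step.
by rewrite iter_par_root //; apply: par_root.
Qed.

(** Forward orbits in two different trees never meet, and levels 0 and 1 of one root meet only if
    they agree modulo [d]. For [d = 0] congruence is equality, so a cycle that keeps the level is
    excluded too. *)
Lemma ascent_unique (X : Type) (f : X -> X) (s : straight_ladders f) r t d r' t' d' :
  single_orbit f ->
  par r = r -> iter (height s) (@par _ _ s) t = r ->
  (forall j, f (srung r j) = srung t (j + d)) ->
  par r' = r' -> iter (height s) (@par _ _ s) t' = r' ->
  (forall j, f (srung r' j) = srung t' (j + d')) ->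
  r = r' /\ d = 1.
Proof.
move=> [_ orb] pr tr Hr pr' tr' Hr'.
have fix_root i : par i = i -> iter (height s) (@par _ _ s) i = i.
  by move=> pi; elim: (height s) => //= k ->.
split.
  have [m [n]] := orb (srung r 0) (srung r' 0).
  have [i [j [-> ir _]]] := ascent_orbit m 0 pr tr Hr (fix_root _ pr).
  have [i' [j' [-> ir' _]]] := ascent_orbit n 0 pr' tr' Hr' (fix_root _ pr').
  by move=> /srung_inj[E _]; rewrite -ir -ir' E.
have [m [n]] := orb (srung r 0) (srung r 1).
have [i [j [-> ir jd]]] := ascent_orbit m 0 pr tr Hr (fix_root _ pr).
have [i' [j' [-> ir' jd']]] := ascent_orbit n 1 pr tr Hr (fix_root _ pr).
move=> /srung_inj[_ E]; move: jd jd'; rewrite E => -> {E}.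
by case: d Hr => [|[|d]] _ //; rewrite mod0n modn_small.
Qed.

(* [base] collects everything below a fixed level.  The roots with positive
   [fall] carry the inward pieces ([landing r = None] for a star); a root with
   [fall r = 0] carries the outward path. *)
Record combed (X : Type) (f : X -> X) := Combed {
  base : finType;
  bin : base -> X;
  cidx : finType;
  crung : cidx -> nat -> X;
  cpar : cidx -> cidx;
  cheight : nat;
  fall : cidx -> nat;
  landing : cidx -> option cidx;
  bin_inj : injective bin;
  crung_inj : forall i j i' j', crung i j = crung i' j' -> i = i' /\ j = j';
  bin_crung : forall y i j, bin y <> crung i j;
  ccover : forall x, (exists y, x = bin y) \/ (exists i j, x = crung i j);
  cpar_root : forall i, cpar (iter cheight cpar i) = iter cheight cpar i;
  crung_step : forall i j, cpar i <> i -> f (crung i j) = crung (cpar i) j;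
  fall_root : forall i, 0 < fall i -> cpar i = i;
  fall_low : forall r j, j < fall r -> exists y, f (crung r j) = bin y;
  fall_high : forall r j, 0 < fall r -> f (crung r (j + fall r)) =
    if landing r is Some t then crung t j else f (crung r j);
  landing_root : forall r t, 0 < fall r -> landing r = Some t -> iter cheight cpar t = r;
  outward_cases :
    ((forall r, cpar r = r -> 0 < fall r) /\ forall y, exists y', f (bin y) = bin y') \/
    (exists r t b,
      [/\ cpar r = r, fall r = 0, iter cheight cpar t = r
        & forall r', cpar r' = r' -> r' <> r -> 0 < fall r'] /\
      [/\ forall j, f (crung r j) = crung t j.+1, f (bin b) = crung t 0
        & forall y, y <> b -> exists y', f (bin y) = bin y']) }.

(** The cut level [J] passes every fall and every level reached from the finite points or from the
    levels [j < dr r] of a falling root. Then only the ascending root leads out of the part below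
    [J], from level [J.-1]. *)
Lemma straight_comb (X : Type) (f : X -> X) :
  single_orbit f -> straight_ladders f -> inhabited (combed f).
Proof.
move=> so s; pose p := @par _ _ s; pose N := height s; pose I := sidx s.
pose e : I -> nat -> X := @srung _ _ s.
have e_inj i j i' j' : e i j = e i' j' -> i = i' /\ j = j' := @srung_inj _ _ s i j i' j'.
pose inward r (d : nat) (t : option I) := [/\ p r = r, 0 < d,
  forall j, f (e r (j + d)) = if t is Some t then e t j else f (e r j)
  & forall t', t = Some t' -> iter N p t' = r].
pose outward r (d : nat) (t : option I) := [/\ p r = r, d = 0
  & exists t', [/\ t = Some t', iter N p t' = r & forall j, f (e r j) = e t' j.+1]].
have [h Hh] : exists h : I -> nat * option I, forall r,
    [\/ p r <> r /\ (h r).1 = 0, inward r (h r).1 (h r).2 | outward r (h r).1 (h r).2].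
  have H r : exists h : nat * option I,
     [\/ p r <> r /\ h.1 = 0, inward r h.1 h.2 | outward r h.1 h.2].
    case: (classic (p r = r)) => pr; last by exists (0, None); constructor 1.
    case: (srung_root pr) => [[x Hx]|[t [tr [[d d_gt0 Hd]|[d Hd]]]]].
    (* A star gets fall 1: with a constant image, one class of levels is enough. *)
    - by exists (1, None); constructor 2; split=> // j; rewrite /= /e !Hx.
    - by exists (d, Some t); constructor 2; split=> //= t' [<-].
    have [_ d1] := ascent_unique so pr tr Hd pr tr Hd.
    exists (0, Some t); constructor 3; split=> //; exists t; split=> // j.
    by rewrite /e Hd d1 addn1.
  by have [choice_f ?] := fun_choice H; exists choice_f.
pose dr r := (h r).1; pose la r := (h r).2.
pose low x J := forall i j, x = e i j -> j < J.
have low_ex x : exists B, forall J, B <= J -> low x J.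
  case: (classic (exists i j, x = e i j)) => [[i [j ->]]|n].
    by exists j.+1 => J hJ i' j' /e_inj[_ <-].
  by exists 0 => J _ i j E; case: n; exists i, j.
have [J1 HJ1] : exists B, forall (y : sfin s) n, B <= n -> low (f (spt y)) n.
  by apply: fin_bound_ex => y; apply: low_ex.
have [J2 HJ2] : exists B, forall r n, B <= n ->
    dr r <= n /\ forall j, j < dr r -> low (f (e r j)) n.
  apply: fin_bound_ex => r.
  have [B HB] : exists B, forall (j : 'I_(dr r)) n, B <= n -> low (f (e r j)) n.
    by apply: fin_bound_ex => j; apply: low_ex.
  exists (B + dr r) => n hn; split=> [|j hj]; first lia.
  by apply: (HB (Ordinal hj)); lia.
pose J := J1 + J2 + 1.
have drJ r : dr r <= J by have [] := HJ2 r J; [rewrite /J; lia|].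
have lowJ r j : j < dr r -> low (f (e r j)) J.
  by move=> hj; have [|_] := HJ2 r J; [rewrite /J; lia|apply].
have star r : inward r (dr r) None -> forall j, exists2 j0, j0 < dr r & f (e r j) = f (e r j0).
  move=> [_ d_gt0 Hd _] j; exists (j %% dr r); first by rewrite ltn_mod.
  rewrite {1}(divn_eq j (dr r)); elim: (_ %/ _) => // k IH.
  by rewrite mulSn -addnA addnC Hd.
have inwardP r j : inward r (dr r) (la r) -> j < J + dr r -> low (f (e r j)) J.
  move=> [pr d_gt0 Hd tr] hj; case El: (la r) Hd tr => [t|] Hd tr; last first.
    by have [j0 hj0 ->] := star r ltac:(by split) j; apply: lowJ.
  case: (ltnP j (dr r)) => hj'; first exact: lowJ.
  by rewrite -(subnK hj') Hd => i j' /e_inj[_ <-]; lia.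
pose g (y : sfin s + I * 'I_J) :=
  match y with inl y => spt y | inr y => e y.1 y.2 end.
have [Y [bi [bi_inj biP]]] := finite_range_enum g (low^~ J).
have bi_low y : low (bi y) J by have [_] := (biP (bi y)).1 (ex_intro _ y erefl).
have low_bi x : low x J -> exists y, x = bi y.
  move=> lx; apply/biP; split=> //; case: (scover s x) => [[y ->]|[i [j Ex]]].
    by exists (inl y).
  by exists (inr (i, Ordinal (lx _ _ Ex))).
have low_f x : low x J -> low (f x) J \/
    exists r, outward r (dr r) (la r) /\ x = e r J.-1.
  move=> lx; case: (scover s x) => [[y ->]|[i [j Ex]]].
    by left; apply: HJ1; rewrite /J; lia.
  have hj := lx _ _ Ex; rewrite Ex -/(e i j); case: (Hh i) => [[pi _]|inw|].
  - left; rewrite /e srung_step // => i' j' /e_inj[_ <-]; exact: hj.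
  - by left; apply: inwardP => //; lia.
  move=> out; have [pi _ [t [_ _ Ht]]] := out.
  case: (eqVneq j J.-1) => [->|jJ]; first by right; exists i.
  by left; rewrite Ht => i' j' /e_inj[_ <-]; lia.
pose e' i j := e i (j + J).
have c1 r : 0 < dr r -> inward r (dr r) (la r).
  by case: (Hh r) => [[_ E]|//|[_ E _]]; rewrite /dr E.
have c2 r : dr r = 0 -> p r = r -> outward r (dr r) (la r).
  case: (Hh r) => [[pr _] _ pr'|[_ d _ _] E _|//]; first by case: pr.
  by rewrite -/(dr r) E in d.
split; apply: (@Combed X f Y bi I e' p N dr la) => //.
- by move=> i j i' j' /e_inj[-> E]; split=> //; apply: addIn E.
- by move=> y i j /bi_low; lia.
- move=> x; case: (classic (low x J)) => [/low_bi|nl]; first by left.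
  have [i [j [Ex hj]]] : exists i j, x = e i j /\ J <= j.
    apply: NNPP => H; apply: nl => i j Ex; rewrite ltnNge; apply/negP => hj.
    by apply: H; exists i, j.
  by right; exists i, (j - J); rewrite /e' subnK.
- exact: par_root.
- by move=> i j pi; apply: srung_step.
- by move=> i /c1[].
- move=> r j hj; apply/low_bi/inwardP; last by lia.
  by apply: c1; lia.
- move=> r j /c1[_ _ Hd _]; rewrite /e' addnAC Hd.
  by case: (la r).
- by move=> r t /c1[_ _ _]; apply.
case: (classic (exists r, outward r (dr r) (la r))) => [[r out]|nout]; last first.
  left; split=> [r pr|y].
    by rewrite lt0n; apply/negP => /eqP d0; apply: nout; exists r; apply: c2.
  have [/low_bi[y' ->]|[r [out _]]] := low_f _ (bi_low y); first by exists y'.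
  by case: nout; exists r.
right; have [pr d0 [t [Et tr Ht]]] := out.
have uniq_out r' : outward r' (dr r') (la r') -> r' = r.
  move=> [pr' d0' [t' [Et' tr' Ht']]].
  have Hs u v : (forall j, f (e u j) = e v j.+1) -> forall j, f (srung u j) = srung v (j + 1).
    by move=> H j; rewrite addn1; apply: H.
  by have [] := ascent_unique so pr' tr' (Hs _ _ Ht') pr tr (Hs _ _ Ht).
have [b Eb] : exists b, e r J.-1 = bi b.
  by apply: low_bi => i j /e_inj[_ <-]; rewrite /J; lia.
exists r, t, b; split; split=> //.
- move=> r' pr' ne; rewrite lt0n; apply/negP => /eqP d0'.
  by apply: ne; apply: uniq_out; apply: c2.
- by move=> j; rewrite /e' Ht.
- by rewrite -Eb Ht /e'; congr e; rewrite /J; lia.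
move=> y yb; have [/low_bi[y' ->]|[r' [out' Er']]] := low_f _ (bi_low y); first by exists y'.
by case: yb; apply: bi_inj; rewrite Er' -Eb (uniq_out _ out').
Qed.

(** * Building the graph from its pieces *)

Definition subtree (I : finType) (p : I -> I) (N : nat) (r : I) : finType :=
  {i : I | iter N p i == r}.

Section Subtree.
Variables (I : finType) (p : I -> I) (N : nat) (r : I).
Hypothesis p_root : forall i, p (iter N p i) = iter N p i.
Hypothesis pr : p r = r.

Lemma root_mem : iter N p r == r.
Proof. by apply/eqP; elim: N => //= k ->. Qed.

Lemma par_mem (u : subtree p N r) : iter N p (p (val u)) == r.
Proof. by rewrite iter_par_root //; apply: (valP u). Qed.

Definition subroot : subtree p N r :=
  exist (fun i => iter N p i == r) r root_mem.
Definition subpar (u : subtree p N r) : subtree p N r :=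
  exist (fun i => iter N p i == r) (p (val u)) (par_mem u).

Lemma fixed_is_root (u : subtree p N r) : p (val u) = val u -> val u = r.
Proof.
move=> pu; have H k : iter k p (val u) = val u by elim: k => //= k ->.
exact: etrans (esym (H N)) (eqP (valP u)).
Qed.

Lemma iter_subpar (u : subtree p N r) k : val (iter k subpar u) = iter k p (val u).
Proof. by elim: k => //= k ->. Qed.

Lemma iter_subpar_root (u : subtree p N r) : iter N subpar u = subroot.
Proof. by apply: val_inj; rewrite iter_subpar; apply/eqP; apply: (valP u). Qed.

Lemma subpar_root : subpar subroot = subroot.
Proof. exact: val_inj. Qed.

Lemma subtree_parent : parent_of
  (fun x y : subtree p N r => (x != subroot) && (y == subpar x)) subroot subpar.
Proof.
by split=> // [|x]; [exact: subpar_root|exists N; exact: iter_subpar_root].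
Qed.

Variable l : option I.
Definition inward_par (x : option (subtree p N r)) : option (subtree p N r) :=
  if x is Some u then (if u == subroot then None else Some (subpar u)) else None.

(** [None] is an extra vertex above the root, with no other neighbour: the leaf [t0]. The landing
    vertex is [t1]; without one, [t1] is [None] too and the template is a star. *)
Definition inward_piece : template :=
  @Template (option (subtree p N r) : finType)
    (fun x y => (x != None) && (y == inward_par x)) None (obind insub l).

Lemma inward_piece_parent : parent_of (te inward_piece) None inward_par.
Proof.
split=> // -[u|]; last by exists 0.
suff gen k w : iter k subpar w = subroot -> exists n, iter n inward_par (Some w) = None.
  exact: gen (iter_subpar_root u).
elim: k w => [|k IH] w; first by move=> /= ->; exists 1; rewrite /= eqxx.
rewrite iterSr => /IH[n En]; case: (eqVneq w subroot) => [->|wr].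
  by exists 1; rewrite /= eqxx.
by exists n.+1; rewrite iterSr /= (negPf wr).
Qed.

Lemma inward_piece_template : inward_template inward_piece.
Proof.
have Hp := inward_piece_parent; split; last exact: parent_oriented Hp.
split; first exact: parent_dtree Hp.
rewrite /leaf (@eq_card1 _ (Some subroot)) // => -[u|]; rewrite !inE /adj //=.
by rewrite (inj_eq Some_inj); case: (u == subroot).
Qed.

Variable t : subtree p N r.
Definition outward_par (x : option (subtree p N r)) : option (subtree p N r) :=
  if x is Some u then Some (subpar u) else Some t.

(** Here [None] stands for the root one copy earlier, and its edge to [t] is the ascending step. *)
Definition outward_piece : template :=
  @Template (option (subtree p N r) : finType)
    (fun x y => (x != Some subroot) && (y == outward_par x)) None (Some subroot).

Lemma outward_piece_parent : parent_of (te outward_piece) (Some subroot) outward_par.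
Proof.
have H u : iter N outward_par (Some u) = Some subroot.
  rewrite -(iter_subpar_root u).
  by have H k : iter k outward_par (Some u) = Some (iter k subpar u) by elim: k => //= k ->.
split=> // [|[u|]]; first by rewrite /= subpar_root.
  by exists N.
by exists N.+1; rewrite iterSr; apply: H.
Qed.

Lemma outward_piece_path : outward_path outward_piece.
Proof.
have Hp := outward_piece_parent; split=> //; last exact: parent_oriented Hp.
split; first exact: parent_dtree Hp.
rewrite /leaf (@eq_card1 _ (Some t)) // => -[u|]; rewrite !inE /adj //=.
by rewrite andbF orbF.
Qed.
End Subtree.

Lemma Srep_valid (P : template) j (u : tT P) : Svalid (Srep j u).
Proof.
rewrite /Srep; case: ifP => [_|/negbT //]; case: j => // j.
by case: ifP => //=; rewrite eq_sym.
Qed.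

(** * Attaching the inward pieces *)

Section Attach.
Variables (X : Type) (f : X -> X) (c : combed f) (B : graph) (i0 : vtx B -> X).
Notation e := (@crung _ _ c).
Notation p := (@cpar _ _ c).
Notation N := (cheight c).
Hypothesis i0_inj : injective i0.
Hypothesis i0_edge : forall x y, edge x y <-> f (i0 x) = i0 y.
Hypothesis i0_closed : forall x, exists y, f (i0 x) = i0 y.
Hypothesis i0_range : forall x, (exists y, x = i0 y) <->
  ~ exists i j, x = e i j /\ 0 < fall (iter N p i).


(** One piece for each root and each residue of the level modulo its fall. *)
Definition pieces : finType := {r : cidx c & 'I_(fall r)}.

Lemma piece_fall (k : pieces) : 0 < fall (tag k).
Proof. exact: leq_ltn_trans (leq0n _) (ltn_ord (tagged k)). Qed.

Definition piece (k : pieces) : template :=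
  inward_piece (@cpar_root _ _ c) (fall_root (piece_fall k)) (landing (tag k)).

Definition piece_map (k : pieces) (v : option (nat * tT (piece k))) : X :=
  if v is Some (j, Some u) then e (val u) (j * fall (tag k) + tagged k)
  else f (e (tag k) (tagged k)).

(** Falling by [d] from level [n.+1 * d + s] moves to the preceding copy, as the template
    prescribes; for a star, all levels of the class share one image. *)
Lemma piece_map_step (k : pieces) (n : nat) (x y : tT (piece k)) :
  te (piece k) x y -> f (piece_map (Srep n x)) = piece_map (Srep n y).
Proof.
case: x => [u|] /andP[] // _ /eqP Ey; rewrite {}Ey {1}/Srep /=.
set d := fall (tag k); set s := nat_of_ord (tagged k).
have d_gt0 : 0 < d := piece_fall k.
rewrite /inward_par; case: eqVneq => [->|ur] /=; last first.
  rewrite crung_step // => /fixed_is_root E; case/negP: ur; apply/eqP.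
  exact: val_inj.
have high j := fall_high j d_gt0.
rewrite /Srep eqxx; case: n => [|n] //=.
have -> : n.+1 * d + s = n * d + s + d by lia.
rewrite high; case El: (landing (tag k)) => [t|] /=.
  by rewrite (insubT (fun i => iter N p i == tag k)) //=; rewrite (landing_root d_gt0 El).
have star j : f (e (tag k) (j + d)) = f (e (tag k) j) by rewrite high El.
elim: n => // n IH; have -> : n.+1 * d + s = n * d + s + d by lia.
by rewrite star.
Qed.

(** [B] is a closed part whose complement consists of the rungs over falling roots, so one argument
    serves both the cycle with trees and the tree with the outward path. *)
Lemma attach_pieces : attach_inward B (map_graph f).
Proof.
pose pk (i : 'I_#|pieces|) : pieces := enum_val i.
have [g gP] : exists g : 'I_#|pieces| -> vtx B, forall i,
    i0 (g i) = f (e (tag (pk i)) (tagged (pk i))).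
  have H i : exists z, i0 z = f (e (tag (pk i)) (tagged (pk i))).
    have [y Ey] := fall_low (ltn_ord (tagged (pk i))).
    have [z ->] : exists z, f (e (tag (pk i)) (tagged (pk i))) = i0 z; last by exists z.
    by apply/i0_range; rewrite Ey => -[i' [j' [/bin_crung]]].
  by have [choice_f ?] := fun_choice H; exists choice_f.
have i0_off z i j : i0 z = e i j -> ~ 0 < fall (iter N p i).
  by move=> E h; case: ((i0_range (i0 z)).1 (ex_intro _ z erefl)); exists i, j.
have root_u (k : pieces) (u : subtree p N (tag k)) : iter N p (val u) = tag k.
  exact/eqP/(valP u).
have cover x : (exists y, x = i0 y) \/
    (exists i (v : Svtx (piece (pk i))), x = piece_map (val v)).
  case: (classic (exists i j, x = e i j /\ 0 < fall (iter N p i))); last first.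
    by move=> /i0_range; left.
  move=> [i [j [-> d_gt0]]]; right.
  (* Division of the level by the fall: the remainder selects the piece, the quotient the copy. *)
  pose k : pieces := Tagged (fun r => 'I_(fall r)) (Ordinal (ltn_pmod j d_gt0)).
  exists (enum_rank k); set k' := pk (enum_rank k).
  have Ek : k = k' by rewrite /k' /pk enum_rankK.
  suff [v ->] : exists v : Svtx (piece k), e i j = piece_map (val v) by rewrite -Ek; exists v.
  pose u : subtree p N (tag k) := exist (fun i' => iter N p i' == tag k) i (eqxx _).
  exists (exist (@Svalid (piece k)) (Some (j %/ fall (tag k), Some u)) isT).
  by rewrite /= -divn_eq.
exists #|pieces|, (fun i => piece (pk i)), g; split.
  by move=> i; apply: inward_piece_template.
exists i0, (fun i v => piece_map (val v)); split; [split|split].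
- exact: i0_inj.
- move=> i [[[j [u|]]|] hu] [[[j' [u'|]]|] hu'] //= E; apply: val_inj => //=.
  + have [Eu Ej] := crung_inj E; have d_gt0 := piece_fall (pk i).
    congr (Some (_, Some _)); last exact: val_inj.
    by move/addIn: Ej => /eqP; rewrite eqn_pmul2r // => /eqP.
  + by case: (i0_off (g i) (val u) (j * fall (tag (pk i)) + tagged (pk i)));
      rewrite ?gP ?E ?root_u ?piece_fall.
  by case: (i0_off (g i) (val u') (j' * fall (tag (pk i)) + tagged (pk i)));
    rewrite ?gP ?E ?root_u ?piece_fall.
- by move=> i; rewrite /= gP.
- move=> i [[[j [u|]]|] hu] y //= E; last by apply: val_inj.
  by case: (i0_off _ _ _ (esym E)); rewrite root_u piece_fall.
- have aux i x y : piece_map (k := pk i) (val x) = i0 y -> x = Sbase (piece (pk i)).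
    case: x => [[[j [u|]]|] hu] //= E; last by apply: val_inj.
    by case: (i0_off _ _ _ (esym E)); rewrite root_u piece_fall.
  move=> i i' x y ii' E.
  case: (classic (x = Sbase _)) => [Ex|nx].
    by split=> //; apply: (aux i' y (g i)); rewrite -E Ex gP.
  case: (classic (y = Sbase _)) => [Ey|ny].
    by split=> //; apply: (aux i x (g i')); rewrite E Ey gP.
  case: ii'; case: x E nx => [[[j [u|]]|] hu] //= E nx; last by case: nx; apply: val_inj.
  case: y E ny => [[[j' [u'|]]|] hu'] //= E ny; last by case: ny; apply: val_inj.
  have [Eu Ej] := crung_inj E; apply: enum_val_inj; rewrite -/(pk i) -/(pk i').
  have Er : tag (pk i) = tag (pk i').
    exact: etrans (esym (root_u _ u)) (etrans (congr1 (iter N p) Eu) (root_u _ u')).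
  move: Ej {E Eu u u' hu hu' nx ny}; case: (pk i) (pk i') Er => [r s] [r' s'] /= Er.
  subst r'; move=> /(congr1 (modn^~ (fall r))); rewrite !modnMDl !modn_small // => Es.
  by congr (Tagged _ _); apply: val_inj.
- exact: cover.
move=> u v; split=> /= [<-|[[x [y [/i0_edge <- -> ->]]] //|[i [x [y [[j [a [b [ab Ea Eb]]]] -> ->]]]]]].
  have in_base z : (exists x y, [/\ edge x y, i0 z = i0 x & f (i0 z) = i0 y]).
    by have [z' Ez'] := i0_closed z; exists z, z'; split=> //; apply/i0_edge.
  case: (cover u) => [[z ->]|[i [x ->]]]; first by left; apply: in_base.
  case: x => [[[j [w|]]|] hx] //=; last by left; rewrite -gP; apply: in_base.
  pose y : tT (piece (pk i)) :=
    inward_par (@cpar_root _ _ c) (fall_root (piece_fall (pk i))) (Some w).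
  have wy : te (piece (pk i)) (Some w) y by rewrite /= eqxx.
  right; exists i, (exist (@Svalid (piece (pk i))) (Some (j, Some w)) hx).
  exists (exist (@Svalid (piece (pk i))) (Srep j y) (Srep_valid _ _)).
  split; first by exists j, (Some w), y.
  - by [].
  by rewrite -(piece_map_step j wy).
by rewrite Ea Eb; apply: piece_map_step.
Qed.
End Attach.

(** * The finite part and the final assembly *)

Lemma periodic_point (Y : finType) (h : Y -> Y) : Y ->
  exists r n, [/\ 0 < n, iter n h r = r &
    forall i j, i < n -> j < n -> iter i h r = iter j h r -> i = j].
Proof.
move=> y0; have [C [reach uniqC]] := cycle_transversal h.
have [k Cr] := reach y0; set r := iter k h y0 in Cr.
have ex : exists n, (0 < n) && (iter n h r == r).
  have [n] := reach (h r); rewrite -iterSr => Cn.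
  by exists n.+1; rewrite /= -[h _]/(iter n.+1 h r) (uniqC r n.+1).
case: (ex_minnP ex) => n /andP[n_gt0 /eqP En] minn; exists r, n; split=> //.
have lt i j : i < j -> j < n -> iter i h r <> iter j h r.
  move=> ij jn E; have : iter (n - j + i) h r = r by rewrite iterD E -iterD subnK // ltnW.
  by move=> /eqP Er; have := minn (n - j + i); rewrite Er; lia.
move=> i j hi hj E; case: (ltngtP i j) => // h1; first by case: (lt _ _ h1 hj).
by case: (lt _ _ h1 hi).
Qed.

(** Stopping [h] on its cycle leaves one tree per cycle vertex, possibly a single point; hence as
    many trees as cycle vertices, attached by the identity. *)
Lemma finite_map_glued (Y : finType) (h : Y -> Y) : single_orbit h ->
  exists n k (R : 'I_k -> rtree) (g : 'I_k -> 'I_n), [/\ 0 < n,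
    forall i, inward_rtree (R i)
    & glued (cycle_graph n) k (fun i => rtree_graph (R i)) (fun i => rroot (R i)) g
        (map_graph h)].
Proof.
move=> [[y0] orb]; have [r [n [n_gt0 En c_inj]]] := periodic_point h y0.
pose c (i : 'I_n) := iter i h r.
have modn_c m : iter m h r = c (Ordinal (ltn_pmod m n_gt0)).
  rewrite {1}(divn_eq m n) addnC iterD /c /=; congr (iter _ _ _).
  by elim: (_ %/ _) => // k IH; rewrite mulSn iterD IH En.
pose C : pred Y := fun y => [exists i, y == c i].
have Cc i : C (c i) by apply/existsP; exists i.
pose p := stop_at C h.
have [N HN] : exists N, forall y, C (iter N p y).
  apply: stop_at_reach => y; have [a [b E]] := orb y r.
  by exists a; rewrite E modn_c.
have p_root y : p (iter N p y) = iter N p y by rewrite {1}/p /stop_at HN.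
have pc i : p (c i) = c i by rewrite /p /stop_at Cc.
pose R i := @RTree (subtree p N (c i))
  (fun x y => (x != subroot N (pc i)) && (y == subpar p_root x)) (subroot N (pc i)).
have root_u i (x : subtree p N (c i)) : iter N p (val x) = c i by apply/eqP/(valP x).
have iter_c i : iter N p (c i) = c i by apply/eqP; apply: root_mem.
exists n, n, R, id; split=> //.
  by move=> i; have Hp := subtree_parent p_root (pc i); split;
    [apply: parent_dtree Hp|apply: parent_oriented Hp].
exists c, (fun i (x : subtree p N (c i)) => val x); split; [split=> //|split].
- by move=> i j /c_inj E; apply: val_inj; apply: E.
- by move=> i x y; apply: val_inj.
- move=> i x y E; apply: val_inj; apply: (etrans E).
  exact: etrans (esym (iter_c y)) (etrans (congr1 (iter N p) (esym E)) (root_u i x)).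
- move=> i j x y ij E; case: ij; apply: val_inj; apply: (c_inj _ _ (ltn_ord i) (ltn_ord j)).
  exact: etrans (esym (root_u i x)) (etrans (congr1 (iter N p) E) (root_u j y)).
- move=> y; have /existsP[i Ei] := HN y; right; exists i.
  by exists (exist (fun y => iter N p y == c i) y Ei).
move=> u v; split=> /= [<-|[[i [j [Ej -> ->]]]|[i [x [y [/andP[xr /eqP ->] -> ->]]]]]].
- case: (boolP (C u)) => [/existsP[i /eqP ->]|nCu].
    left; exists i, (Ordinal (ltn_pmod i.+1 n_gt0)); split=> //.
    by rewrite -modn_c.
  have /existsP[i Ei] := HN u; right; exists i.
  pose x : subtree p N (c i) := exist (fun y => iter N p y == c i) u Ei.
  exists x, (subpar p_root x); split=> //; last by rewrite /= /p /stop_at (negPf nCu).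
  rewrite eqxx andbT; apply/negP => /eqP/(congr1 val) /= Eu.
  by rewrite Eu Cc in nCu.
- rewrite -[h _]/(iter i.+1 h r) modn_c; congr (iter _ _ _).
  by rewrite /= -Ej.
rewrite /= /p /stop_at; case: ifP => // Cx; case/negP: xr; apply/eqP/val_inj => /=.
by apply: (fixed_is_root (p := p) (N := N)); rewrite /p /stop_at Cx.
Qed.

Lemma combed_obtainable (X : Type) (f : X -> X) :
  single_orbit f -> combed f -> obtainable1 (map_graph f) \/ obtainable2 (map_graph f).
Proof.
move=> [[x0] orb] c; pose p := @cpar _ _ c; pose N := cheight c.
pose e := @crung _ _ c; pose bi := @bin _ _ c.
have p_root i : p (iter N p i) = iter N p i := @cpar_root _ _ c i.
case: (outward_cases c) => [[pos closed]|[r [t [b [[pr fr tr others] [Hr Hb closed]]]]]].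
  left; have [h Hh] : exists h : base c -> base c, forall y, bi (h y) = f (bi y).
    exists (fun y => proj1_sig (constructive_indefinite_description _ (closed y))) => y.
    by case: constructive_indefinite_description => y' /= ->.
  have so : single_orbit h.
    split.
      case: (ccover c x0) => [[y _]|[i [j _]]]; first by exists.
      (* The root below which [x0] lies has positive fall, so its level 0 drops into the base. *)
      by have [y _] := fall_low (pos _ (p_root i)); exists.
    have it m y : bi (iter m h y) = iter m f (bi y) by elim: m => //= m <-; rewrite Hh.
    by move=> x y; have [m [n E]] := orb (bi x) (bi y); exists m, n; apply: bin_inj; rewrite -/bi !it.
  have [n [k [R [g [n_gt0 HR gl]]]]] := finite_map_glued so.
  exists n, k, R, g, (map_graph h); split=> //.
  apply: (@attach_pieces _ _ c (map_graph h) bi) => [x y /bin_inj //|x y|x|x].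
  - by split=> [<-|]; rewrite ?Hh // -Hh => /bin_inj.
  - by exists (h x); rewrite Hh.
  split=> [[y ->] [i [j [/bin_crung]]] //|n0].
  case: (ccover c x) => // -[i [j Ex]]; case: n0; exists i, j; split=> //.
  exact: pos.
right.
pose U := subtree p N r; pose u0 : U := subroot N pr.
pose ut : U := exist (fun i => iter N p i == r) t (introT eqP tr).
have u_nonroot (u : U) : u != u0 -> p (val u) <> val u.
  by move=> ur /fixed_is_root E; case/negP: ur; apply/eqP/val_inj.
have root_u (u : U) : iter N p (val u) = r by apply/eqP/(valP u).
(* The base together with all rungs over [r], which form the outward path. *)
pose Z : Type := (base c + U * nat)%type.
pose io (z : Z) : X := match z with inl y => bi y | inr w => e (val w.1) w.2 end.
have io_inj : injective io.
  move=> [y|[u j]] [y'|[u' j']] //=; first by move=> /bin_inj ->.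
  - by move/bin_crung.
  - by move/esym/bin_crung.
  by move/crung_inj => [/val_inj -> ->].
pose B := @Graph Z (fun x y => f (io x) = io y).
have step_u (u : U) j : u != u0 -> f (e (val u) j) = io (inr (subpar p_root u, j)).
  by move=> /u_nonroot h; rewrite /e crung_step.
have [h Hh] : exists h : base c -> base c, forall y, y <> b -> f (bi y) = bi (h y).
  have H y : exists y', y <> b -> f (bi y) = bi y'.
    case: (classic (y = b)) => [E|/closed[y' Ey']]; last by exists y'.
    (* The value at [b] is arbitrary; [pb] replaces it by [b]. *)
    by exists y => /(_ E).
  by have [choice_f ?] := fun_choice H; exists choice_f.
(* An orbit avoiding [b] would stay in the base, while the orbit of [b] leaves at once for the
   outward path and never returns; the two would not meet. *)
have reach y : exists n, iter n h y = b.
  apply: NNPP => H; have it m : iter m f (bi y) = bi (iter m h y).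
    by elim: m => //= m ->; rewrite Hh // => E; apply: H; exists m.
  have [m [n]] := orb (bi y) (bi b); rewrite it; case: n => [|n].
    by move/bin_inj => E; apply: H; exists m.
  rewrite iterSr Hb.
  have [w [j ->]] : exists (w : U) j, iter n f (e (val ut) 0) = e (val w) j; last by move/bin_crung.
  elim: n => [|n [w [j IH]]]; first by exists ut, 0.
  rewrite iterS IH; case: (eqVneq w u0) => [->|/step_u ->]; last by exists (subpar p_root w), j.
  by exists ut, j.+1; apply: Hr.
pose pb := stop_at (pred1 b) h.
pose R := @RTree (base c) (fun x y => (x != b) && (y == pb x)) b.
have pbE y : y != b -> pb y = h y by rewrite /pb /stop_at /= => /negPf ->.
have pbb : pb b = b by rewrite /pb /stop_at /= eqxx.
have HR : inward_rtree R.
  have Hp : parent_of (re R) b pb.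
    split=> // y; have [|M HM] := @stop_at_reach _ (pred1 b) h.
      by move=> x; have [n En] := reach x; exists n; apply/eqP.
    by exists M; apply/eqP; apply: HM.
  by split; [apply: parent_dtree Hp|apply: parent_oriented Hp].
pose P := outward_piece p_root pr ut.
pose om (v : option (nat * tT P)) : Z := if v is Some (j, Some u) then inr (u, j) else inl b.
have om_step n x y : te P x y -> f (io (om (Srep n x))) = io (om (Srep n y)).
  case: x => [u|] /andP[ur /eqP Ey]; rewrite {}Ey.
    by rewrite /Srep /= step_u.
  by rewrite /Srep /=; case: n => [|n] /=; [exact: Hb|exact: Hr].
have te0 : te P None (Some ut) by rewrite /= eqxx.
exists R, P, B; split=> //; first exact: outward_piece_path.
  exists inl, (fun _ v => om (val v)); split; [split|split].
  - by move=> x y [].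
  - move=> i [[[j [u|]]|] hu] [[[j' [u'|]]|] hu'] //= E; apply: val_inj => //=.
    by case: E => -> ->.
  - by [].
  - by move=> i [[[j [u|]]|] hu] y //= _; apply: val_inj.
  - by move=> i j; rewrite !ord1.
  - move=> [y|[u j]]; first by left; exists y.
    by right; exists ord0, (exist (@Svalid P) (Some (j, Some u)) isT).
  move=> z z'; split=> [E|[[x [y [/andP[xb /eqP ->] -> ->]]]|[i [x [y [[n [a [a' [aa Ea Ea']]]] -> ->]]]]]].
  - case: z E => [y|[u j]] /= E.
      case: (eqVneq y b) => [Ey|yb].
        right; exists ord0, (Sbase P), (exist (@Svalid P) (Some (0, Some ut)) isT).
        split; [by exists 0, None, (Some ut)|by rewrite Ey|].
        by apply: io_inj; rewrite -E Ey -/bi Hb.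
      left; exists y, (h y); split=> //; first by rewrite /= yb pbE ?eqxx.
      by apply: io_inj; rewrite -E /= Hh //; apply/eqP.
    right; case: (eqVneq u u0) => [Eu|uu].
      exists ord0, (exist (@Svalid P) (Some (j, Some u)) isT).
      exists (exist (@Svalid P) (Some (j.+1, Some ut)) isT).
      split=> //; first by exists j.+1, None, (Some ut); rewrite Eu.
      by apply: io_inj; rewrite -E Eu /=; apply: Hr.
    exists ord0, (exist (@Svalid P) (Some (j, Some u)) isT).
    exists (exist (@Svalid P) (Some (j, Some (subpar p_root u))) isT).
    split=> //; last by apply: io_inj; rewrite -E step_u.
    by exists j, (Some u), (Some (subpar p_root u)); rewrite /= (inj_eq Some_inj) uu eqxx.
  - by rewrite /= pbE // Hh //; apply/eqP.
  by rewrite /edge /= Ea Ea'; apply: om_step.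
apply: (@attach_pieces _ _ c B io) => [//|//|z|x].
- case: z => [y|[u j]] /=.
    case: (classic (y = b)) => [->|/Hh ->]; last by exists (inl (h y)).
    by exists (inr (ut, 0)); apply: Hb.
  case: (eqVneq u u0) => [->|/step_u ->]; last by exists (inr (subpar p_root u, j)).
  by exists (inr (ut, j.+1)); apply: Hr.
split=> [[[y|[u j]] ->] [i [j' [/= E]]]|n0].
- by case: (bin_crung E).
- by have [<- _] := crung_inj E; rewrite root_u fr.
case: (ccover c x) => [[y ->]|[i [j Ex]]]; first by exists (inl y).
have ir : iter N p i == r.
  apply/eqP; apply: NNPP => ne; case: n0; exists i, j; split=> //.
  exact: others (p_root i) ne.
by exists (inr (exist (fun i => iter N p i == r) i ir, j)).
Qed.

Theorem theorem7p2 (X : Type) (f : X -> X) :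
  single_orbit f ->
  (unary_FA_presentable f <->
     obtainable1 (map_graph f) \/ obtainable2 (map_graph f)).
Proof.
move=> so; split=> [/presentable_ladders[l]|ob].
  have [s] := ladders_straighten l; have [c] := straight_comb so s.
  exact: combed_obtainable so c.
have [l] : inhabited (ladders (map_graph f)).
  by case: ob => [/obtainable1_ladders|/obtainable2_ladders].
by apply: ladders_presentable l; case: so.
Qed.
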